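(* Let $A$ be a lattice with zero. The following conditions are equivalent: (i) $A$ is amenable; (ii) $A$ is locally finite and $A\otimes B$ is a lattice, for every lattice $B$ with zero; (iii) $A$ is locally finite and $A\otimes F(3)$ is a lattice, where $F(3)$ is the free lattice on three generators; (iv) $A$ is locally finite and every finite sublattice of $A$ satisfies the condition $(\mathrm{T}_\vee)$.
   Context: A lattice is locally finite if each of its finitely generated sublattices is finite. Tensor product. For lattices $A$, $B$ with least elements $0$, put $\bot_{A,B}=(A\times\{0\})\cup(\{0\}\times B)$. A bi-ideal of $A\times B$ is a subset $I\subseteq A\times B$ which is a down-set (for the componentwise order), contains $\bot_{A,B}$, and is closed under lateral joins: $(a,b_0),(a,b_1)\in I$ implies $(a,b_0\vee b_1)\in I$, and $(a_0,b),(a_1,b)\in I$ implies $(a_0\vee a_1,b)\in I$. Ordered by inclusion, the bi-ideals form an algebraic lattice $A\,\bar\otimes\, B$. For $a\in A$, $b\in B$ the pure tensor is the bi-ideal $a\otimes b=\bot_{A,B}\cup\{(x,y)\in A\times B : x\le a,\ y\le b\}$. The tensor product $A\otimes B$ is the join-semilattice with zero of compact elements of $A\,\bar\otimes\,B$, i.e. the set of all finite joins (in $A\,\bar\otimes\,B$) of pure tensors, ordered by inclusion. ''$A\otimes B$ is a lattice'' means that this ordered set is a lattice. $A\otimes B$ is a capped tensor product if every element of $A\otimes B$ is a finite union (as sets) of pure tensors. A lattice $A$ with zero is amenable if $A\otimes L$ is a capped tensor product for every lattice $L$ with zero. Condition $(\mathrm{T}_\vee)$. For a finite lattice $K$, $\mathrm{J}(K)$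 is the set of (nonzero) join-irreducible elements of $K$. For subsets $X,Y$ of $K$, $X\ll Y$ means that for every $x\in X$ there is $y\in Y$ with $x\le y$. A minimal pair of $K$ is a pair $(p,I)$ with $p\in\mathrm{J}(K)$, $I\subseteq\mathrm{J}(K)$, such that $p\notin I$, $p\le\bigvee I$, and for all $J\subseteq\mathrm{J}(K)$, if $J\ll I$ and $p\le\bigvee J$, then $I\subseteq J$. The finite lattice $K$ satisfies $(\mathrm{T}_\vee)$ if $\mathrm{J}(K)$ has a linear order $\trianglelefteq$ such that, for every minimal pair $(p,J)$ of $K$, $p\trianglelefteq j$ holds for every $j\in J$. *)

(* Defs.v *)
From HB Require Import structures.
From mathcomp Require Import all_boot all_order finmap generic_quotient.
From mathcomp Require Import boolp classical_sets cardinality.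

Set Implicit Arguments.
Unset Strict Implicit.
Unset Printing Implicit Defensive.

Import Order.TTheory.
Local Open Scope order_scope.

Section BiIdeals.
Context (dA dB : Order.disp_t) (A : bLatticeType dA) (B : bLatticeType dB).
Local Open Scope classical_set_scope.

Definition tbot : set (A * B) := [set p | p.1 = \bot \/ p.2 = \bot].

Record is_biideal (I : set (A * B)) : Prop := IsBiideal {
  biideal_down : forall a b a' b', a <= a' -> b <= b' -> I (a', b') -> I (a, b);
  biideal_bot : tbot `<=` I;
  biideal_joinr : forall a b0 b1,
    I (a, b0) -> I (a, b1) -> I (a, Order.join b0 b1);
  biideal_joinl : forall a0 a1 b,
    I (a0, b) -> I (a1, b) -> I (Order.join a0 a1, b) }.

(* [set (A * B)] is ordered by inclusion, and
   subtypes inherit this order. *)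
Record biideal := Biideal {
  biideal_set :> set (A * B);
  biideal_setP : `[< is_biideal biideal_set >] }.

HB.instance Definition _ := [isSub for biideal_set].
HB.instance Definition _ := [Choice of biideal by <:].
HB.instance Definition _ := [SubChoice_isSubPOrder of biideal by <: with set_display].

Lemma biideal_leE (I J : biideal) : (I <= J) = `[< I `<=` J >].
Proof. by []. Qed.

Definition pure_set (a : A) (b : B) : set (A * B) :=
  tbot `|` [set p | p.1 <= a /\ p.2 <= b].

Lemma pure_set_biideal a b : is_biideal (pure_set a b).
Proof.
split.
- move=> x y x' y' xx' yy' [[/= ?|/= ?]|[/= xa yb]].
  + by left; left; apply/eqP; rewrite -lex0 /=; subst x'.
  + by left; right; apply/eqP; rewrite -lex0 /=; subst y'.
  + by right; split; [exact: le_trans xa|exact: le_trans yb].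
- by move=> p tp; left.
- move=> x y0 y1 [[/= ->|/= ->]|[/= xa y0b]].
  + by left; left.
  + by rewrite join0x.
  + case=> [[/= ->|/= ->]|[/= _ y1b]]; first by left; left.
      by rewrite joinx0; right.
    by right; split=> //=; rewrite leUx y0b y1b.
- move=> x0 x1 y [[/= ->|/= ->]|[/= x0a yb]].
  + by rewrite join0x.
  + by left; right.
  + case=> [[/= ->|/= ->]|[/= x1a _]]; last 1 first.
    * by right; split=> //=; rewrite leUx x0a x1a.
    * by rewrite joinx0; right.
    * by left; right.
Qed.

Definition pure (a : A) (b : B) : biideal := Biideal (asboolT (pure_set_biideal a b)).

(* These are the compact bi-ideals.  The supremum is taken in the lattice of all
   bi-ideals, so it is in general larger than the union. *)
Definition fin_join_pure (I : biideal) : Prop :=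
  exists s : seq (A * B), supremums [set pure p.1 p.2 | p in [set` s]] I.

Record tensor := Tensor {
  tensor_biideal :> biideal;
  tensor_biidealP : `[< fin_join_pure tensor_biideal >] }.

HB.instance Definition _ := [isSub for tensor_biideal].
HB.instance Definition _ := [Choice of tensor by <:].
HB.instance Definition _ := [SubChoice_isSubPOrder of tensor by <: with set_display].

Definition capped : Prop :=
  forall I : tensor, exists s : seq (A * B),
    biideal_set I = \bigcup_(p in [set` s]) pure_set p.1 p.2.

End BiIdeals.

Notation "A ⊗ B" := (tensor A B) (at level 40, left associativity) : type_scope.

Definition is_lattice (d : Order.disp_t) (T : porderType d) : Prop :=
  forall x y : T,
    (supremums [set x; y] !=set0 /\ infimums [set x; y] !=set0)%classic.

Definition amenable (d : Order.disp_t) (A : bLatticeType d) : Prop :=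
  forall (dL : Order.disp_t) (L : bLatticeType dL), capped A L.

Definition is_sublattice (d : Order.disp_t) (A : latticeType d) (S : set A) : Prop :=
  forall x y, S x -> S y -> S (x `&` y) /\ S (x `|` y).

Definition locally_finite (d : Order.disp_t) (A : latticeType d) : Prop :=
  forall X : set A, finite_set X -> finite_set (smallest (@is_sublattice d A) X).

(* Nonempty finite sublattices; each one is, as a type, a [finTBLatticeType],
   whose bounds are its own and need not be bounds of [A]. *)
Record fin_sublattice (d : Order.disp_t) (A : latticeType d) := FinSublattice {
  fsl_carrier : {fset A};
  fsl_neq0 : fsl_carrier != fset0;
  fsl_closed : is_sublattice [set` fsl_carrier]%classic }.

Definition fsl_sort d (A : latticeType d) (K : fin_sublattice A) : predArgType :=
  fset_sub_type (fsl_carrier K).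
Coercion fsl_sort : fin_sublattice >-> predArgType.

Section FinSublattice.
Context (d : Order.disp_t) (A : latticeType d) (K : fin_sublattice A).

HB.instance Definition _ := Finite.copy (fsl_sort K) (fset_sub_type (fsl_carrier K)).
HB.instance Definition _ := SubType.copy (fsl_sort K) (fset_sub_type (fsl_carrier K)).
HB.instance Definition _ := [SubChoice_isSubPOrder of fsl_sort K by <: with d].

Fact fsl_meet_closed :
  {in mem (fsl_carrier K) &, forall x y : A, x `&` y \in mem (fsl_carrier K)}.
Proof. by move=> x y xK yK; have [] := fsl_closed xK yK. Qed.

Fact fsl_join_closed :
  {in mem (fsl_carrier K) &, forall x y : A, x `|` y \in mem (fsl_carrier K)}.
Proof. by move=> x y xK yK; have [] := fsl_closed xK yK. Qed.

HB.instance Definition _ := Order.SubPOrder_isSubLattice.Build d A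
  (mem (fsl_carrier K)) d (fsl_sort K) fsl_meet_closed fsl_join_closed.

Fact fsl_inhabited : exists x : fsl_sort K, true.
Proof. by have /fset0Pn [x xK] := fsl_neq0 K; exists [` xK]%fset. Qed.

Definition fsl_bot : fsl_sort K :=
  foldr Order.meet (xchoose fsl_inhabited) (enum (fsl_sort K)).
Definition fsl_top : fsl_sort K :=
  foldr Order.join (xchoose fsl_inhabited) (enum (fsl_sort K)).

Fact fsl_le0x (x : fsl_sort K) : fsl_bot <= x.
Proof.
have: x \in enum (fsl_sort K) by rewrite mem_enum.
rewrite /fsl_bot; elim: (enum _) => //= y s IH.
by rewrite inE => /predU1P[->|/IH sx]; apply: leIx2; rewrite ?lexx ?sx ?orbT.
Qed.

Fact fsl_lex1 (x : fsl_sort K) : x <= fsl_top.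
Proof.
have: x \in enum (fsl_sort K) by rewrite mem_enum.
rewrite /fsl_top; elim: (enum _) => //= y s IH.
by rewrite inE => /predU1P[->|/IH xs]; apply: lexU2; rewrite ?lexx ?xs ?orbT.
Qed.

HB.instance Definition _ := Order.hasBottom.Build d (fsl_sort K) fsl_le0x.
HB.instance Definition _ := Order.hasTop.Build d (fsl_sort K) fsl_lex1.

End FinSublattice.

Section TJoin.
Context (d : Order.disp_t) (K : finTBLatticeType d).
Local Open Scope set_scope.

Definition join_irreducibles : {set K} :=
  [set p | (p != \bot) &&
    [forall x, forall y, (p == x `|` y) ==> (p == x) || (p == y)]].
Local Notation J := join_irreducibles.

Definition refines (X Y : {set K}) : Prop :=
  forall x, x \in X -> exists2 y, y \in Y & x <= y.

Definition minimal_pair (p : K) (I : {set K}) : Prop :=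
  [/\ p \in J, I \subset J, p \notin I, p <= \join_(i in I) i &
      forall I' : {set K}, I' \subset J -> refines I' I ->
        p <= \join_(i in I') i -> I \subset I'].

Definition linear_order_on (X : {set K}) (r : rel K) : Prop :=
  [/\ {in X, reflexive r}, {in X &, antisymmetric r},
      {in X & &, transitive r} & {in X &, total r}].

Definition T_join : Prop :=
  exists r : rel K, linear_order_on J r /\
    forall p I, minimal_pair p I -> forall i, i \in I -> r p i.

End TJoin.

Inductive lterm (X : Type) : Type :=
| LVar of X
| LMeet of lterm X & lterm X
| LJoin of lterm X & lterm X.

(* The inequalities between lattice terms that hold in all lattices: the least
   preorder for which [LMeet] and [LJoin] are meets and joins. *)
Inductive lterm_le (X : Type) : lterm X -> lterm X -> Prop :=
| lterm_le_refl t : lterm_le t t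
| lterm_le_trans u t v : lterm_le t u -> lterm_le u v -> lterm_le t v
| lterm_leIl t u : lterm_le (LMeet t u) t
| lterm_leIr t u : lterm_le (LMeet t u) u
| lterm_lexI t u v : lterm_le t u -> lterm_le t v -> lterm_le t (LMeet u v)
| lterm_leUl t u : lterm_le t (LJoin t u)
| lterm_leUr t u : lterm_le u (LJoin t u)
| lterm_leUx t u v : lterm_le t v -> lterm_le u v -> lterm_le (LJoin t u) v.

HB.instance Definition _ X := gen_eqMixin (lterm X).
HB.instance Definition _ X := gen_choiceMixin (lterm X).

Fact free_display : Order.disp_t. Proof. by []. Qed.

Section FreeLattice.
Variable X : Type.
Implicit Types t u v : lterm X.
Local Open Scope quotient_scope.

Definition lterm_eqv t u : bool := `[< lterm_le t u /\ lterm_le u t >].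

Fact lterm_eqv_refl : reflexive lterm_eqv.
Proof. by move=> t; apply/asboolP; split; exact: lterm_le_refl. Qed.

Fact lterm_eqv_sym : symmetric lterm_eqv.
Proof. by move=> t u; apply/asboolP/asboolP => -[]. Qed.

Fact lterm_eqv_trans : transitive lterm_eqv.
Proof.
move=> u t v /asboolP[tu ut] /asboolP[uv vu]; apply/asboolP.
by split; [exact: lterm_le_trans tu uv|exact: lterm_le_trans vu ut].
Qed.

Canonical lterm_equiv := EquivRel lterm_eqv lterm_eqv_refl lterm_eqv_sym lterm_eqv_trans.

Definition free_lattice : Type := {eq_quot lterm_equiv}.
HB.instance Definition _ := Choice.copy free_lattice {eq_quot lterm_equiv}.
HB.instance Definition _ := Quotient.copy free_lattice {eq_quot lterm_equiv}.

Definition free_le (x y : free_lattice) : bool := `[< lterm_le (repr x) (repr y) >].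
Definition free_meet (x y : free_lattice) : free_lattice :=
  \pi_free_lattice (LMeet (repr x) (repr y)).
Definition free_join (x y : free_lattice) : free_lattice :=
  \pi_free_lattice (LJoin (repr x) (repr y)).
Definition free_gen (x : X) : free_lattice := \pi_free_lattice (LVar x).

Lemma free_eqP t u :
  \pi_free_lattice t = \pi_free_lattice u <-> lterm_le t u /\ lterm_le u t.
Proof.
by split => [/eqmodP/asboolP//|tu]; apply/eqmodP/asboolP.
Qed.

Lemma free_reprK t :
  lterm_le t (repr (\pi_free_lattice t)) /\ lterm_le (repr (\pi_free_lattice t)) t.
Proof. by apply/free_eqP; rewrite reprK. Qed.

Fact free_le_refl : reflexive free_le.
Proof. by move=> x; apply/asboolP; exact: lterm_le_refl. Qed.

Fact free_le_anti : antisymmetric free_le.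
Proof.
move=> x y /andP[/asboolP xy /asboolP yx].
by rewrite -(reprK x) -(reprK y); apply/free_eqP.
Qed.

Fact free_le_trans : transitive free_le.
Proof.
move=> y x z /asboolP xy /asboolP yz; apply/asboolP.
exact: lterm_le_trans yz.
Qed.

HB.instance Definition _ := Order.Le_isPOrder.Build free_display free_lattice
  free_le_refl free_le_anti free_le_trans.

Fact free_lexI (x y z : free_lattice) : (x <= free_meet y z) = (x <= y) && (x <= z).
Proof.
have [le1 le2] := free_reprK (LMeet (repr y) (repr z)).
apply/asboolP/andP => [xyz|[/asboolP xy /asboolP xz]].
  have {}xyz := lterm_le_trans xyz le2.
  by split; apply/asboolP; apply: lterm_le_trans xyz _; constructor.
by apply: lterm_le_trans le1; constructor.
Qed.

Fact free_leUx (x y z : free_lattice) : (free_join x y <= z) = (x <= z) && (y <= z).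
Proof.
have [le1 le2] := free_reprK (LJoin (repr x) (repr y)).
apply/asboolP/andP => [xyz|[/asboolP xz /asboolP yz]].
  have {}xyz := lterm_le_trans le1 xyz.
  by split; apply/asboolP; apply: lterm_le_trans xyz; constructor.
by apply: lterm_le_trans le2 _; constructor.
Qed.

HB.instance Definition _ :=
  Order.POrder_isMeetSemilattice.Build free_display free_lattice free_lexI.
HB.instance Definition _ :=
  Order.POrder_isJoinSemilattice.Build free_display free_lattice free_leUx.

Lemma free_leE t u :
  (\pi_free_lattice t <= \pi_free_lattice u) = `[< lterm_le t u >].
Proof.
have [t1 t2] := free_reprK t; have [u1 u2] := free_reprK u.
apply/asboolP/asboolP => tu.
  exact: lterm_le_trans t1 (lterm_le_trans tu u2).
exact: lterm_le_trans t2 (lterm_le_trans tu u1).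
Qed.

Lemma free_meetE t u :
  \pi_free_lattice (LMeet t u) = \pi_free_lattice t `&` \pi_free_lattice u.
Proof.
apply/le_anti/andP; split.
  by rewrite lexI !free_leE; apply/andP; split; apply/asboolP; constructor.
have [t1 t2] := free_reprK t; have [u1 u2] := free_reprK u.
rewrite [_ `&` _]/(free_meet _ _) free_leE; apply/asboolP; apply: lterm_lexI.
  by apply: lterm_le_trans t2; constructor.
by apply: lterm_le_trans u2; constructor.
Qed.

Lemma free_joinE t u :
  \pi_free_lattice (LJoin t u) = \pi_free_lattice t `|` \pi_free_lattice u.
Proof.
apply/le_anti/andP; split; last first.
  by rewrite leUx !free_leE; apply/andP; split; apply/asboolP; constructor.
have [t1 t2] := free_reprK t; have [u1 u2] := free_reprK u.
rewrite [_ `|` _]/(free_join _ _) free_leE; apply/asboolP; apply: lterm_leUx.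
  by apply: lterm_le_trans t1 _; constructor.
by apply: lterm_le_trans u1 _; constructor.
Qed.

Lemma free_ind (P : free_lattice -> Prop) :
  (forall x, P (free_gen x)) ->
  (forall x y, P x -> P y -> P (x `&` y)) ->
  (forall x y, P x -> P y -> P (x `|` y)) -> forall x, P x.
Proof.
move=> Pg PI PU x; rewrite -(reprK x); elim: (repr x) => [//|t Pt u Pu|t Pt u Pu].
  by rewrite free_meetE; exact: PI.
by rewrite free_joinE; exact: PU.
Qed.

Fixpoint lterm_eval d (L : latticeType d) (v : X -> L) t : L :=
  match t with
  | LVar x => v x
  | LMeet t u => lterm_eval v t `&` lterm_eval v u
  | LJoin t u => lterm_eval v t `|` lterm_eval v u
  end.

Lemma lterm_eval_le d (L : latticeType d) (v : X -> L) t u :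
  lterm_le t u -> lterm_eval v t <= lterm_eval v u.
Proof.
elim=> {t u} //= [u t w _ tu _ uw|t u|t u|t u w _ tu _ tw|t u|t u|t u w _ tw _ uw].
- exact: le_trans uw.
- exact: leIl.
- exact: leIr.
- by rewrite lexI tu tw.
- exact: leUl.
- exact: leUr.
- by rewrite leUx tw uw.
Qed.

Theorem free_lattice_universal d (L : latticeType d) (v : X -> L) :
  exists! f : free_lattice -> L,
    [/\ forall x, f (free_gen x) = v x, {morph f : x y / x `&` y} &
        {morph f : x y / x `|` y}].
Proof.
have ev t : lterm_eval v (repr (\pi_free_lattice t)) = lterm_eval v t.
  by have [? ?] := free_reprK t; apply/le_anti; rewrite !lterm_eval_le.
exists (fun x => lterm_eval v (repr x)); split.
  by split=> [x|x y|x y]; rewrite ?ev // -[x]reprK -[y]reprK;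
    rewrite -?free_meetE -?free_joinE !ev.
move=> g [gv gI gU]; apply/funext; apply: free_ind => [x|x y gx gy|x y gx gy].
- by rewrite ev gv.
- by rewrite gI -gx -gy -{1}[x]reprK -{1}[y]reprK -free_meetE ev.
- by rewrite gU -gx -gy -{1}[x]reprK -{1}[y]reprK -free_joinE ev.
Qed.

End FreeLattice.

(* The free lattice on three generators; the meet of the generators is its zero. *)
Definition F3 : Type := free_lattice 'I_3.
HB.instance Definition _ := Order.Lattice.copy F3 (free_lattice 'I_3).

Definition F3_gen (i : 'I_3) : F3 := free_gen i.
Definition F3_bot : F3 := F3_gen (inord 0) `&` F3_gen (inord 1) `&` F3_gen (inord 2).

Fact F3_le0x (x : F3) : F3_bot <= x.
Proof.
elim/free_ind: x => [i|x y x0 y0|x y x0 _]; last 2 first.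
- by rewrite lexI x0 y0.
- exact: lexU2 (introT orP (or_introl x0)).
have: i = inord i by rewrite inord_val.
case: i => -[|[|[|//]]] /= _ ->; rewrite -/(F3_gen _) /F3_bot.
- by rewrite -meetA leIl.
- by rewrite meetAC leIr.
- by rewrite leIr.
Qed.

HB.instance Definition _ := Order.hasBottom.Build free_display F3 F3_le0x.

(* Main.v *)
From HB Require Import structures.
Require Import Defs.
From mathcomp Require Import all_boot all_order finmap.
From mathcomp Require Import boolp classical_sets cardinality.

Set Implicit Arguments.
Unset Strict Implicit.
Unset Printing Implicit Defensive.

Import Order.TTheory.
Local Open Scope order_scope.

(* The bi-ideal generated by the pure tensors a_i ⊗ x_i consists of the pairs below
   some (t(a), t^d(x)), where t is a lattice term and t^d its dual.  Taking for x_i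
   the element a_i of the dual of A, a finite cap bounds the sublattice generated
   by the a_i, so amenable lattices are locally finite; and capped tensor products
   are closed under intersection.

   If A ⊗ F(3) is a lattice and K is a finite sublattice of A, use that F(3)
   contains a free lattice on K to form the bi-ideal H generated by the k ⊗ x_k.
   For p in J(K), compactness of the intersection of H with p ⊗ 1 makes the section
   of H at p principal: by duality, there is a least term t with p <= t(K).  When
   (p, I) is a minimal pair, Whitman's condition, applied to the cover of t by the
   least terms of the elements of I, exhibits each of the latter as a proper
   subterm of t (up to equivalence), so that the size of the least terms orders
   J(K) as required by (T_\/).

   Conversely, under (T_\/) the equations
   f p = f_0 p \/ sup_{(p, I) minimal pair} inf_{i in I} f i
   have a solution, by recursion along the order of J(K), and the pure tensors
   k ⊗ inf_{p <= k} f p cap the bi-ideal generated by finitely many a ⊗ x, where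
   f_0 p is the join of the x with p <= a. *)

(** * Whitman's solution of the word problem *)

Section Whitman.
Variable X : Type.
Implicit Types t u v w : lterm X.

(* A cut-free presentation of [lterm_le]: transitivity is not a rule. *)
Inductive whitman_le : lterm X -> lterm X -> Prop :=
| wh_var x : whitman_le (LVar x) (LVar x)
| wh_joinl t u v : whitman_le t v -> whitman_le u v -> whitman_le (LJoin t u) v
| wh_meetr t u v : whitman_le v t -> whitman_le v u -> whitman_le v (LMeet t u)
| wh_meetl1 t u v : whitman_le t v -> whitman_le (LMeet t u) v
| wh_meetl2 t u v : whitman_le u v -> whitman_le (LMeet t u) v
| wh_joinr1 t u v : whitman_le v t -> whitman_le v (LJoin t u)
| wh_joinr2 t u v : whitman_le v u -> whitman_le v (LJoin t u).
Hint Constructors whitman_le : core.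

Lemma whitman_refl t : whitman_le t t.
Proof. by elim: t => *; auto. Qed.

Lemma whitman_joinl t u v :
  whitman_le (LJoin t u) v -> whitman_le t v /\ whitman_le u v.
Proof.
move Ew: (LJoin t u) => w le; elim: le Ew => //.
- by move=> t' u' v' ? _ ? _ [-> ->].
- by move=> t' u' v' _ IH1 _ IH2 /[dup] /IH1[? ?] /IH2[? ?]; auto.
- by move=> t' u' v' _ IH /IH[? ?]; auto.
- by move=> t' u' v' _ IH /IH[? ?]; auto.
Qed.

Lemma whitman_meetr t u v :
  whitman_le v (LMeet t u) -> whitman_le v t /\ whitman_le v u.
Proof.
move Ew: (LMeet t u) => w le; elim: le Ew => //.
- by move=> t' u' v' _ IH1 _ IH2 /[dup] /IH1[? ?] /IH2[? ?]; auto.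
- by move=> t' u' v' ? _ ? _ [-> ->].
- by move=> t' u' v' _ IH /IH[? ?]; auto.
- by move=> t' u' v' _ IH /IH[? ?]; auto.
Qed.

(** Cut elimination: an outer induction on the cut term [u], an inner one on a derivation. If [u] is
    a meet or a join, one premise is inverted and the inner induction runs on the other. *)
Lemma whitman_trans t u v : whitman_le t u -> whitman_le u v -> whitman_le t v.
Proof.
elim: u t v => [x|a IHa b IHb|a IHa b IHb] t v.
- move Ew: (LVar x) => w le; elim: le Ew => //.
  + by move=> t' u' v' _ IH1 _ IH2 ? ?; apply: wh_joinl; auto.
  + by move=> t' u' v' _ IH ? ?; apply: wh_meetl1; auto.
  + by move=> t' u' v' _ IH ? ?; apply: wh_meetl2; auto.
- move=> /whitman_meetr[ta tb]; move Ew: (LMeet a b) => w le; elim: le Ew => //.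
  + by move=> t' u' v' _ IH1 _ IH2 ?; apply: wh_meetr; auto.
  + by move=> t' u' v' le _ [? ?]; subst; apply: IHa le.
  + by move=> t' u' v' le _ [? ?]; subst; apply: IHb le.
  + by move=> t' u' v' _ IH ?; apply: wh_joinr1; auto.
  + by move=> t' u' v' _ IH ?; apply: wh_joinr2; auto.
- move=> tab /whitman_joinl[av bv]; move Ew: (LJoin a b) tab => w le.
  elim: le Ew => //.
  + by move=> t' u' v' _ IH1 _ IH2 ?; apply: wh_joinl; auto.
  + by move=> t' u' v' _ IH ?; apply: wh_meetl1; auto.
  + by move=> t' u' v' _ IH ?; apply: wh_meetl2; auto.
  + by move=> t' u' v' le _ [? ?]; subst; apply: IHa av.
  + by move=> t' u' v' le _ [? ?]; subst; apply: IHb bv.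
Qed.

Lemma lterm_le_whitman t u : lterm_le t u <-> whitman_le t u.
Proof.
split; elim=> {t u}; try by move=> *; constructor.
- exact: whitman_refl.
- by move=> u t v _ tu _; apply: whitman_trans.
- by move=> t u; apply: wh_meetl1; apply: whitman_refl.
- by move=> t u; apply: wh_meetl2; apply: whitman_refl.
- by move=> t u; apply: wh_joinr1; apply: whitman_refl.
- by move=> t u; apply: wh_joinr2; apply: whitman_refl.
- by move=> t u v _ tv; apply: lterm_le_trans tv; constructor.
- by move=> t u v _ tv; apply: lterm_le_trans tv; constructor.
- by move=> t u v _ tv; apply: lterm_le_trans tv _; constructor.
- by move=> t u v _ tv; apply: lterm_le_trans tv _; constructor.
Qed.

Lemma lterm_le_joinE t u v : lterm_le (LJoin t u) v <-> lterm_le t v /\ lterm_le u v.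
Proof.
split=> [le|[]]; last exact: lterm_leUx.
by split; apply: lterm_le_trans le; constructor.
Qed.

Lemma lterm_le_meetE t u v : lterm_le t (LMeet u v) <-> lterm_le t u /\ lterm_le t v.
Proof.
split=> [le|[]]; last exact: lterm_lexI.
by split; apply: lterm_le_trans le _; constructor.
Qed.

Lemma lterm_le_var (x y : X) : lterm_le (LVar x) (LVar y) -> x = y.
Proof. by move=> /lterm_le_whitman le; inversion le. Qed.

Lemma lterm_le_var_join (x : X) u v : lterm_le (LVar x) (LJoin u v) ->
  lterm_le (LVar x) u \/ lterm_le (LVar x) v.
Proof. by move=> /lterm_le_whitman le; inversion le; rewrite !lterm_le_whitman; auto. Qed.

Lemma lterm_le_meet_var (x : X) t u : lterm_le (LMeet t u) (LVar x) ->
  lterm_le t (LVar x) \/ lterm_le u (LVar x).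
Proof. by move=> /lterm_le_whitman le; inversion le; rewrite !lterm_le_whitman; auto. Qed.

Lemma lterm_le_meet_join t u v w : lterm_le (LMeet t u) (LJoin v w) ->
  [\/ lterm_le t (LJoin v w), lterm_le u (LJoin v w),
      lterm_le (LMeet t u) v | lterm_le (LMeet t u) w].
Proof.
move=> /lterm_le_whitman le; inversion le; subst.
- by constructor 1; apply/lterm_le_whitman.
- by constructor 2; apply/lterm_le_whitman.
- by constructor 3; apply/lterm_le_whitman.
- by constructor 4; apply/lterm_le_whitman.
Qed.

End Whitman.

(* Running out of fuel answers [true]. *)
Fixpoint whitman_dec (X : eqType) (n : nat) (t u : lterm X) : bool :=
  if n is n'.+1 then
    match t, u with
    | LJoin t1 t2, _ => whitman_dec n' t1 u && whitman_dec n' t2 u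
    | _, LMeet u1 u2 => whitman_dec n' t u1 && whitman_dec n' t u2
    | LVar x, LVar y => x == y
    | LVar x, LJoin u1 u2 => whitman_dec n' t u1 || whitman_dec n' t u2
    | LMeet t1 t2, LVar x => whitman_dec n' t1 u || whitman_dec n' t2 u
    | LMeet t1 t2, LJoin u1 u2 =>
        [|| whitman_dec n' t1 u, whitman_dec n' t2 u,
            whitman_dec n' t u1 | whitman_dec n' t u2]
    end
  else true.

(** A [false] answer, whatever the fuel, is a refutation: concrete inequalities can be refuted by
    computation. *)
Lemma whitman_dec_complete (X : eqType) n (t u : lterm X) :
  lterm_le t u -> whitman_dec n t u.
Proof.
elim: n t u => // n IHn [x|t1 t2|t1 t2] [y|u1 u2|u1 u2] /=;
  rewrite ?lterm_le_joinE ?lterm_le_meetE.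
- by move=> le; apply/eqP; apply: lterm_le_var le.
- by case=> /IHn -> /IHn ->.
- by move=> le; case: (lterm_le_var_join le) => /IHn ->; rewrite ?orbT.
- by move=> le; case: (lterm_le_meet_var le) => /IHn ->; rewrite ?orbT.
- by case=> /IHn -> /IHn ->.
- by move=> le; case: (lterm_le_meet_join le) => /IHn ->; rewrite ?orbT.
- by case=> /IHn -> /IHn ->.
- by case=> [[? ?] [? ?]]; rewrite !IHn ?lterm_le_meetE.
- by case=> /IHn -> /IHn ->.
Qed.

(** * Independent families *)

Fixpoint lsubst X Y (s : X -> lterm Y) (t : lterm X) : lterm Y :=
  match t with
  | LVar x => s x
  | LMeet t1 t2 => LMeet (lsubst s t1) (lsubst s t2)
  | LJoin t1 t2 => LJoin (lsubst s t1) (lsubst s t2)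
  end.

Fixpoint ldual X (t : lterm X) : lterm X :=
  match t with
  | LVar x => LVar x
  | LMeet t1 t2 => LJoin (ldual t1) (ldual t2)
  | LJoin t1 t2 => LMeet (ldual t1) (ldual t2)
  end.

Lemma ldualK X : involutive (@ldual X).
Proof. by elim=> //= t -> u ->. Qed.

Lemma ldual_le X (t u : lterm X) : lterm_le t u -> lterm_le (ldual u) (ldual t).
Proof.
elim=> {t u} /=; try by move=> *; constructor.
by move=> u t v _ tu _ uv; apply: lterm_le_trans tu.
Qed.

Lemma lsubst_le X Y (s : X -> lterm Y) (t u : lterm X) :
  lterm_le t u -> lterm_le (lsubst s t) (lsubst s u).
Proof.
elim=> {t u} /=; try by move=> *; constructor.
by move=> u t v _ tu _ uv; apply: lterm_le_trans uv.
Qed.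

Lemma lsubst_comp X Y Z (s : Y -> lterm Z) (r : X -> lterm Y) t :
  lsubst s (lsubst r t) = lsubst (fun x => lsubst s (r x)) t.
Proof. by elim: t => //= t -> u ->. Qed.

Lemma lsubst_var X (t : lterm X) : lsubst (@LVar X) t = t.
Proof. by elim: t => //= t -> u ->. Qed.

Lemma ldual_subst X Y (s : X -> lterm Y) t :
  ldual (lsubst s t) = lsubst (fun x => ldual (s x)) (ldual t).
Proof. by elim: t => //= t -> u ->. Qed.

(* [b] stands for the join of the other members of the family, which does not
   exist when [X] is infinite; the substitution [s] makes room for it. *)
Definition join_separated X Y (x : X -> lterm Y) : Prop :=
  forall i, exists (s : Y -> lterm nat) (b : lterm nat),
    (forall j, j <> i -> lterm_le (lsubst s (x j)) b) /\
    ~ lterm_le (lsubst s (x i)) b.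

(** By induction on [w], each [lsubst x w] lies above [x i] or is sent by [s] below [b]. If both [u]
    and [v] fell in the second case, [s] would send [x i] below [b]. *)
Lemma join_separated_prime X Y (x : X -> lterm Y) : join_separated x ->
  forall i u v, lterm_le (x i) (LJoin (lsubst x u) (lsubst x v)) ->
    lterm_le (x i) (lsubst x u) \/ lterm_le (x i) (lsubst x v).
Proof.
move=> sep i u v; have [s [b [xb xib]]] := sep i.
have dich w : lterm_le (x i) (lsubst x w) \/ lterm_le (lsubst s (lsubst x w)) b.
  elim: w => [j|t [t1|t1] u' [u1|u1]|t [t1|t1] u' [u1|u1]] /=.
  - have [<-|/xb] := pselect (j = i); last by right.
    by left; exact: lterm_le_refl.
  - by left; constructor.
  - by right; apply: lterm_le_trans u1; constructor.
  - by right; apply: lterm_le_trans t1; constructor.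
  - by right; apply: lterm_le_trans t1; constructor.
  - by left; apply: lterm_le_trans t1 _; constructor.
  - by left; apply: lterm_le_trans t1 _; constructor.
  - by left; apply: lterm_le_trans u1 _; constructor.
  - by right; constructor.
have [|ub] := dich u; first by left.
have [|vb] := dich v; first by right.
move=> /(lsubst_le s) /= le; case: xib; apply: lterm_le_trans le _.
exact: lterm_leUx.
Qed.

Definition ldual_family X Y (x : X -> lterm Y) (i : X) : lterm Y := ldual (x i).

(** By Whitman's conditions it suffices that the [x i] are pairwise incomparable, and join-prime and
    meet-prime relative to the terms they generate; meets below joins behave well for arbitrary
    terms. *)
Lemma separated_embedding X Y (x : X -> lterm Y) :
  join_separated x -> join_separated (ldual_family x) ->
  forall t u, lterm_le (lsubst x t) (lsubst x u) -> lterm_le t u.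
Proof.
move=> jsep msep; elim=> [i|t1 IH1 t2 IH2|t1 IH1 t2 IH2] u /=; last first.
- by rewrite !lterm_le_joinE => -[/IH1 ? /IH2 ?].
- elim: u => [j|u1 IHu1 u2 IHu2|u1 IHu1 u2 IHu2] /=.
  + have dE w : lsubst (ldual_family x) (ldual w) = ldual (lsubst x w).
      by rewrite ldual_subst.
    move=> /ldual_le /=; rewrite -!dE => /(join_separated_prime msep).
    rewrite !dE /ldual_family => -[/ldual_le|/ldual_le]; rewrite !ldualK.
    * by move=> /(IH1 (LVar j)) le; apply: lterm_le_trans le; constructor.
    * by move=> /(IH2 (LVar j)) le; apply: lterm_le_trans le; constructor.
  + by rewrite !lterm_le_meetE => -[/IHu1 ? /IHu2 ?].
  + case/lterm_le_meet_join.
    * by move=> /(IH1 (LJoin u1 u2)) le; apply: lterm_le_trans le; constructor.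
    * by move=> /(IH2 (LJoin u1 u2)) le; apply: lterm_le_trans le; constructor.
    * by move=> /IHu1 le; apply: lterm_le_trans le _; constructor.
    * by move=> /IHu2 le; apply: lterm_le_trans le _; constructor.
- elim: u => [j|u1 IHu1 u2 IHu2|u1 IHu1 u2 IHu2] /=.
  + have [->|ij] := pselect (i = j); first by move=> _; exact: lterm_le_refl.
    have [s [b [xb xib]]] := jsep i.
    move=> /(lsubst_le s) le; case: xib; apply: lterm_le_trans le (xb j _).
    exact: nesym.
  + by rewrite !lterm_le_meetE => -[/IHu1 ? /IHu2 ?].
  + case/(@join_separated_prime _ _ _ jsep) => [/IHu1|/IHu2] le;
      by apply: lterm_le_trans le _; constructor.
Qed.

(** * Four independent terms in three variables *)

Section ShiftFour.
Local Notation x := (LVar 0%N).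
Local Notation y := (LVar 1%N).
Local Notation z := (LVar 2%N).
Local Infix "∧" := (@LMeet _) (at level 40).
Local Infix "∨" := (@LJoin _) (at level 50).

(* The first four terms form an independent family in three variables; they were
   found by a computer search. *)
Definition shift4 (i : nat) : lterm nat :=
  match i with
  | 0 => (x ∧ y) ∨ z
  | 1 => (x ∨ z) ∧ y
  | 2 => ((x ∨ y) ∧ z) ∨ ((y ∨ z) ∧ x)
  | 3 => ((x ∧ z) ∨ y) ∧ ((y ∧ z) ∨ x)
  | i'.+1 => LVar i'
  end.

(** Isolates the first four terms: the rest of the family collapses to [x ∧ y ∧ z]. *)
Definition only3 (i : nat) : lterm nat :=
  match i with 0 | 1 | 2 => LVar i | _ => x ∧ y ∧ z end.

(** Isolates the variable [n], since [x] is not below [x ∧ y]. *)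
Definition only (n i : nat) : lterm nat := if i == n then x else x ∧ y.

Lemma lsubst_bound X Y (s : X -> lterm Y) b t :
  (forall i, lterm_le (s i) b) -> lterm_le (lsubst s t) b.
Proof.
move=> sb; elim: t => //= [t tb u _|t tb u ub]; last exact: lterm_leUx.
by apply: lterm_le_trans tb; constructor.
Qed.

Lemma lterm_le_joinl X (t u v : lterm X) : lterm_le t u -> lterm_le t (u ∨ v).
Proof. by move=> tu; apply: lterm_le_trans tu _; constructor. Qed.

Lemma lterm_le_joinr X (t u v : lterm X) : lterm_le t v -> lterm_le t (u ∨ v).
Proof. by move=> tu; apply: lterm_le_trans tu _; constructor. Qed.
#[local] Hint Resolve lterm_le_joinl lterm_le_joinr lterm_le_refl : core.

(** Stated for any [g] so as to apply to [shift4] and to its dual family. The first four terms are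
    compared by computation, a fuel of 20 being enough for the answer [false]. *)
Lemma family4_join_separated (g : nat -> lterm nat) :
  (forall i, g i.+4 = LVar i.+3) ->
  (forall i n, (i < 4)%N -> lsubst (only n.+3) (g i) = lsubst (fun=> x ∧ y) (g i)) ->
  (forall i j k l, perm_eq [:: i; j; k; l] (iota 0 4) ->
     ~~ whitman_dec 20 (g i) (g j ∨ g k ∨ g l ∨ (x ∧ y ∧ z))) ->
  (forall i, (i < 4)%N -> lsubst only3 (g i) = g i) ->
  join_separated g.
Proof.
move=> gV gonly gsep gsub.
have sep4 i j k l : perm_eq [:: i; j; k; l] (iota 0 4) -> exists (s : nat -> lterm nat) b,
    (forall m, m <> i -> lterm_le (lsubst s (g m)) b) /\ ~ lterm_le (lsubst s (g i)) b.
  move=> P; exists only3, (g j ∨ g k ∨ g l ∨ (x ∧ y ∧ z)).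
  have mem m : (m \in [:: i; j; k; l]) = (m < 4)%N.
    by rewrite (perm_mem P) mem_iota.
  split=> [m mi|]; last first.
    by rewrite gsub -?mem ?mem_head // => /(whitman_dec_complete 20); apply/negP/gsep.
  have [m4|] := ltnP m 4.
    rewrite gsub //; move: m4; rewrite -mem !inE => /or4P[/eqP//|||] /eqP->; auto.
  by case: m {mi} => [|[|[|[|m]]]] // _; rewrite gV /=; auto.
case=> [|[|[|[|i]]]].
- exact: (@sep4 0%N 1%N 2%N 3%N).
- exact: (@sep4 1%N 0%N 2%N 3%N).
- exact: (@sep4 2%N 0%N 1%N 3%N).
- exact: (@sep4 3%N 0%N 1%N 2%N).
exists (only i.+3), (x ∧ y); split=> [m mi|]; last first.
  by rewrite gV /= /only eqxx => /(whitman_dec_complete 20).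
have [m4|] := ltnP m 4; first by rewrite gonly //; apply: lsubst_bound.
case: m mi => [|[|[|[|m]]]] // mi _; rewrite gV /= /only.
by case: eqP => // -[mi']; case: mi; rewrite mi'.
Qed.

Lemma perm_iota4 i j k l : perm_eq [:: i; j; k; l] (iota 0 4) ->
  [/\ (i < 4)%N, (j < 4)%N, (k < 4)%N, (l < 4)%N & uniq [:: i; j; k; l]].
Proof.
move=> P; have mem m : (m < 4)%N = (m \in [:: i; j; k; l]).
  by rewrite (perm_mem P) mem_iota.
by split; rewrite ?(perm_uniq P) // mem !inE eqxx ?orbT.
Qed.

Lemma shift4_join_separated : join_separated shift4.
Proof.
apply: family4_join_separated => //; try by case=> [|[|[|[|]]]].
move=> i j k l /perm_iota4[].
by move: i j k l; do 4!(case=> [|[|[|[|//]]]]).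
Qed.

Lemma shift4_meet_separated : join_separated (ldual_family shift4).
Proof.
apply: family4_join_separated => //; try by case=> [|[|[|[|]]]].
move=> i j k l /perm_iota4[].
by move: i j k l; do 4!(case=> [|[|[|[|//]]]]).
Qed.

End ShiftFour.

Fixpoint lvars_below (n : nat) (t : lterm nat) : bool :=
  match t with
  | LVar i => (i < n)%N
  | LMeet t1 t2 | LJoin t1 t2 => lvars_below n t1 && lvars_below n t2
  end.

Lemma lsubst_eq_below n X (s r : nat -> lterm X) t :
  lvars_below n t -> (forall i, (i < n)%N -> s i = r i) -> lsubst s t = lsubst r t.
Proof.
by move=> + sr; elim: t => /= [i /sr//|t IHt u IHu|t IHt u IHu] /andP[/IHt-> /IHu->].
Qed.

Lemma shift4_embedding t u :
  lterm_le (lsubst shift4 t) (lsubst shift4 u) -> lterm_le t u.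
Proof.
by apply: separated_embedding; [exact: shift4_join_separated|exact: shift4_meet_separated].
Qed.

Lemma shift4_below n t : lvars_below n.+4 t -> lvars_below n.+3 (lsubst shift4 t).
Proof.
elim: t => [[|[|[|[|i]]]]|t IHt u IHu|t IHt u IHu] //= /andP[/IHt -> /IHu ->] //.
Qed.

Lemma iter_shift4_below n t :
  lvars_below (n + 3) t -> lvars_below 3 (iter n (lsubst shift4) t).
Proof.
elim: n t => // n IHn t tn; rewrite iterSr; apply: IHn.
by rewrite addn3; apply: shift4_below; rewrite -addn3.
Qed.

Lemma iter_shift4_subst n X (s : X -> lterm nat) t :
  lsubst (fun i => iter n (lsubst shift4) (s i)) t =
  iter n (lsubst shift4) (lsubst s t).
Proof. by elim: n t => //= n IHn t; rewrite -IHn lsubst_comp. Qed.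

(* Each step of the iteration trades three of the variables for four, so that
   #|Y| steps bring down to three variables a term over #|Y| + 3 variables. *)
Lemma lterm_I3_embedding (Y : finType) (y0 : Y) :
  exists x : Y -> lterm 'I_3,
    forall t u, lterm_le (lsubst x t) (lsubst x u) -> lterm_le t u.
Proof.
pose g (k : Y) := iter #|Y| (lsubst shift4) (LVar (enum_rank k : nat)).
exists (fun k => lsubst (fun i => LVar (inord i)) (g k)) => t u.
have gK k : lsubst (fun i : 'I_3 => LVar (i : nat))
    (lsubst (fun i => LVar (inord i)) (g k)) = g k.
  rewrite lsubst_comp -[RHS]lsubst_var.
  apply: (@lsubst_eq_below 3) => [|i i3 /=]; last by rewrite inordK.
  by apply: iter_shift4_below; rewrite /= ltn_addr.
move=> /(lsubst_le (fun i : 'I_3 => LVar (i : nat))); rewrite !lsubst_comp.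
rewrite (_ : (fun k => _) = g); last by apply/funext.
rewrite !iter_shift4_subst.
have {gK} : forall n t u, lterm_le (iter n (lsubst shift4) t)
    (iter n (lsubst shift4) u) -> lterm_le t u.
  by elim=> // n IHn t' u' /= /shift4_embedding /IHn.
(* Ranks are renamed back to elements of [Y]; all are in range, so the default [y0] is never
   reached. *)
move=> /[apply] /(lsubst_le (fun i => LVar (nth y0 (enum Y) i))).
rewrite !lsubst_comp (_ : (fun k => _) = @LVar Y) ?lsubst_var //.
by apply/funext => k; rewrite /= nth_enum_rank.
Qed.

Lemma lterm_eval_free X Y (x : X -> lterm Y) t :
  lterm_eval (fun k => (\pi_(free_lattice Y) (x k))%qT) t =
  (\pi_(free_lattice Y) (lsubst x t))%qT.
Proof. by elim: t => //= t -> u ->; rewrite (free_meetE, free_joinE). Qed.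

(** * Subterms and join covers *)

Fixpoint lsize X (t : lterm X) : nat :=
  match t with
  | LVar _ => 1
  | LMeet t1 t2 | LJoin t1 t2 => (lsize t1 + lsize t2).+1
  end.

Fixpoint lsubterm X (u t : lterm X) : Prop :=
  u = t \/
  match t with
  | LVar _ => False
  | LMeet t1 t2 | LJoin t1 t2 => lsubterm u t1 \/ lsubterm u t2
  end.

Lemma lsubterm_refl X (t : lterm X) : lsubterm t t.
Proof. by case: t; left. Qed.

Lemma lsubterm_size X (u t : lterm X) : lsubterm u t -> u = t \/ (lsize u < lsize t)%N.
Proof.
have sub a b c : c = a \/ (lsize c < lsize a)%N -> (lsize c < (lsize a + lsize b).+1)%N.
  by move=> [->|ca]; rewrite ltnS ?leq_addr // ltnW // ltn_addr.
elim: t => /= [x [|]|t1 IH1 t2 IH2|t1 IH1 t2 IH2]; [by left|by []| |];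
  (case=> [->|[/IH1 ut|/IH2 ut]]; [by left|right; exact: sub|]);
  by right; rewrite addnC; exact: sub.
Qed.

(** Lattice terms have no empty join, hence the separate [v]. *)
Definition ljoin X (v : lterm X) (V : seq (lterm X)) : lterm X := foldr (@LJoin X) v V.

Lemma lterm_le_ljoin X v V (w : lterm X) : w \in v :: V -> lterm_le w (ljoin v V).
Proof.
elim: V => [|u V IH]; first by rewrite inE => /eqP->; exact: lterm_le_refl.
rewrite !in_cons => /or3P[wv|/eqP->|wV]; last 2 first.
- exact: lterm_leUl.
- by apply: lterm_le_joinr; apply: IH; rewrite in_cons wV orbT.
- by apply: lterm_le_joinr; apply: IH; rewrite in_cons wv.
Qed.

(* Whitman's condition makes join covers in a free lattice refine to join
   covers by subterms. *)
Lemma ljoin_cover_refine d (L : latticeType d) X (e : X -> L) (t : lterm X) v V :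
  lterm_le t (ljoin v V) ->
  exists U : seq (lterm X),
    (forall u, u \in U -> lsubterm u t /\ exists2 w, w \in v :: V & lterm_le u w) /\
    forall b, (forall u, u \in U -> lterm_eval e u <= b) -> lterm_eval e t <= b.
Proof.
have triv s w : w \in v :: V -> lterm_le s w -> exists U : seq (lterm X),
    (forall u, u \in U -> lsubterm u s /\ exists2 w, w \in v :: V & lterm_le u w) /\
    forall b, (forall u, u \in U -> lterm_eval e u <= b) -> lterm_eval e s <= b.
  move=> wV sw; exists [:: s]; split=> [u|b]; last by apply; rewrite inE.
  by rewrite inE => /eqP ->; split; [exact: lsubterm_refl|exists w].
elim: t => [x|t1 IH1 t2 IH2|t1 IH1 t2 IH2] le.
- have [w wV xw] : exists2 w, w \in v :: V & lterm_le (LVar x) w.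
    elim: V le {triv} => [|u V IH] /= le; first by exists v; rewrite ?inE.
    have [le'|/IH[w wV ?]] := lterm_le_var_join le.
      by exists u; rewrite ?inE ?eqxx ?orbT.
    by exists w => //; move: wV; rewrite !inE => /orP[|] ->; rewrite ?orbT.
  exact: triv xw.
(* Whitman's condition peels off the members of the join one by one: the meet is below one of them,
   or one of its factors is below the whole join. *)
- have : (exists2 w, w \in v :: V & lterm_le (LMeet t1 t2) w) \/
      lterm_le t1 (ljoin v V) \/ lterm_le t2 (ljoin v V).
    elim: V le {triv IH1 IH2} => [|u V IH] /= le; first by left; exists v; rewrite ?inE.
    have [?|?|?|] := lterm_le_meet_join le; [by right; left|by right; right|..].
      by left; exists u; rewrite ?inE ?eqxx ?orbT.
    case/IH=> [[w wV ?]|[le'|le']].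
    + left; exists w => //.
      by move: wV; rewrite !inE => /orP[|] ->; rewrite ?orbT.
    + by right; left; apply: lterm_le_trans le' _; constructor.
    + by right; right; apply: lterm_le_trans le' _; constructor.
  case=> [[w wV ?]|[/IH1[U [US UL]]|/IH2[U [US UL]]]]; first exact: triv wV _.
    exists U; split=> [u /US[? ?]|b /UL tb]; first by split=> //=; auto.
    by apply: le_trans tb; exact: leIl.
  exists U; split=> [u /US[? ?]|b /UL tb]; first by split=> //=; auto.
  by apply: le_trans tb; exact: leIr.
- move: le; rewrite lterm_le_joinE => -[/IH1[U1 [U1S U1L]] /IH2[U2 [U2S U2L]]].
  exists (U1 ++ U2); split=> [u|b Ub].
    by rewrite mem_cat => /orP[/U1S|/U2S] [? ?]; split=> //=; auto.
  rewrite /= leUx U1L ?U2L // => u uU; apply: Ub; rewrite mem_cat uU ?orbT //.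
Qed.

(** * Join-irreducible elements of finite lattices *)

Section FiniteLattice.
Context (d : Order.disp_t) (K : finTBLatticeType d).
Local Open Scope set_scope.
Implicit Types (p q x y : K) (I Q : {set K}).
Local Notation J := (join_irreducibles K).

Lemma jiP p : reflect (p != \bot /\ forall x y, p = x `|` y -> p = x \/ p = y) (p \in J).
Proof.
rewrite inE; apply: (iffP andP) => -[p0 pJ]; split=> //.
  move=> x y /eqP pxy; move: pJ => /forallP/(_ x)/forallP/(_ y)/implyP/(_ pxy).
  by case/orP=> /eqP; auto.
apply/forallP => x; apply/forallP => y; apply/implyP => /eqP /pJ[]->;
  by rewrite eqxx ?orbT.
Qed.

(** Induction on the number of elements strictly below [x]: a nonzero [x] outside [J] is the join of
    two strictly smaller elements. *)
Lemma ji_le x y : {in J, forall p, p <= x -> p <= y} -> x <= y.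
Proof.
have [n] := ubnP #|[set z | z < x]|; elim: n x => // n IH x /ltnSE xn xy.
have [->|x0] := eqVneq x \bot; first exact: le0x.
have [xJ|] := boolP (x \in J); first exact: xy.
rewrite inE x0 /= => /forallPn[x1 /forallPn[x2]].
rewrite negb_imply negb_or => /andP[/eqP x12 /andP[xx1 xx2]].
have sub z : z < x -> (forall p, p \in J -> p <= z -> p <= y) -> z <= y.
  move=> zx; apply: IH; apply: leq_trans xn; apply: proper_card.
  apply/fintype.properP; split; last by exists z; rewrite !inE ?zx ?ltxx.
  by apply/fintype.subsetP => w; rewrite !inE => /lt_trans; apply.
rewrite x12 leUx; apply/andP; split; apply: sub.
- by rewrite lt_neqAle eq_sym xx1 /= [leRHS]x12 leUl.
- by move=> p pJ px1; apply: xy; rewrite // x12 lexU2 ?px1.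
- by rewrite lt_neqAle eq_sym xx2 /= [leRHS]x12 leUr.
- by move=> p pJ px2; apply: xy; rewrite // x12 lexU2 ?px2 ?orbT.
Qed.

(** Otherwise the smaller element could be removed: the rest still refines [I] and covers [p]. *)
Lemma minimal_pair_antichain p I : minimal_pair p I ->
  {in I &, forall x y, x <= y -> x = y}.
Proof.
move=> [_ IJ _ pI Imin] x y xI yI xy; apply/eqP/negPn/negP => x_y.
have yIx : y \in I :\ x by rewrite !inE eq_sym x_y.
suff /fintype.subsetP/(_ x xI) : I \subset I :\ x by rewrite !inE eqxx.
apply: Imin; first by apply/fintype.subsetP => z /setD1P[_ /(fintype.subsetP IJ)].
  by move=> z /setD1P[_ zI]; exists z.
apply: le_trans pI _; apply/joinsP => z zI.
have [->|zx] := eqVneq z x; first by apply: joins_min xy.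
by apply: joins_sup; rewrite !inE zx.
Qed.

(** [I] consists of the maximal elements of a minimal set [D] among the down-sets of [J] that refine
    [Q] and cover [p]. Down-sets turn refinement into inclusion. *)
Lemma join_cover_refine p Q : p \in J -> Q \subset J -> p <= \join_(q in Q) q ->
  exists I, [/\ I \subset J, refines I Q, p <= \join_(i in I) i &
    p \in I \/ minimal_pair p I].
Proof.
move=> pJ QJ pQ.
pose P (D : {set K}) := [&& D \subset J,
  [forall x in D, [exists y in Q, x <= y]],
  [forall x in D, [forall y in J, (y <= x) ==> (y \in D)]] &
  p <= \join_(i in D) i].
have PQ : P [set x in J | [exists y in Q, x <= y]].
  apply/and4P; split.
  - by apply/fintype.subsetP => x; rewrite inE => /andP[].
  - by apply/forall_inP => x; rewrite inE => /andP[].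
  - apply/forall_inP => x; rewrite inE => /andP[_ /exists_inP[y yQ xy]].
    apply/forall_inP => z zJ; apply/implyP => zx; rewrite inE zJ.
    by apply/exists_inP; exists y => //; apply: le_trans zx xy.
  - apply: le_trans pQ _; apply/joinsP => q qQ; apply: joins_sup.
    by rewrite inE (fintype.subsetP QJ) //=; apply/exists_inP; exists q.
have [D /minsetP[/and4P[/fintype.subsetP DJ DQ Ddown pD] Dmin] _] := minset_exists PQ.
have down x y : x \in D -> y \in J -> y <= x -> y \in D.
  by move=> /(forall_inP Ddown)/forall_inP h /h/implyP.
pose I := [set x in D | [forall y in D, (x <= y) ==> (x == y)]].
have IDs x : x \in I -> x \in D by rewrite inE => /andP[].
have maxI x y : x \in I -> y \in D -> x <= y -> x = y.
  by rewrite inE => /andP[_ /forall_inP h] /h/implyP h' /h'/eqP.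
have toI x : x \in D -> exists2 y, y \in I & x <= y.
  have [n] := ubnP #|[set z | x < z]|; elim: n x => // n IH x /ltnSE xn xD.
  have [xI|] := boolP (x \in I); first by exists x.
  rewrite inE xD => /forall_inPn[y yD]; rewrite negb_imply => /andP[xy x_y].
  have {x_y}xy : x < y by rewrite lt_neqAle x_y.
  have [|z zI yz] := IH y _ yD; last by exists z => //; apply: le_trans (ltW xy) yz.
  apply: leq_trans xn; apply: proper_card; apply/fintype.properP; split.
    by apply/fintype.subsetP => w; rewrite !inE; apply: lt_trans.
  by exists y; rewrite !inE ?xy ?ltxx.
have pI : p <= \join_(i in I) i.
  by apply: le_trans pD _; apply/joinsP => x /toI[y yI xy]; apply: joins_min xy.
have IJ : I \subset J by apply/fintype.subsetP => x /IDs/DJ.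
exists I; split=> //.
  by move=> x /IDs/(forall_inP DQ)/exists_inP.
have [|pNI] := boolP (p \in I); [by left|right; split=> //].
move=> I' I'J I'I pI'.
(* The down-set generated by [I'] lies in [D] and covers [p], so it is [D]; a maximal element of [D]
   then lies below, hence equals, a member of [I']. *)
pose D' := [set x in J | [exists y in I', x <= y]].
have D'D : D' \subset D.
  apply/fintype.subsetP => x; rewrite inE => /andP[xJ /exists_inP[y /I'I[z /IDs zD yz] xy]].
  exact: down zD xJ (le_trans xy yz).
have D'E : D' = D.
  apply: (Dmin _ _ D'D); apply/and4P; split.
  - by apply/fintype.subsetP => x; rewrite inE => /andP[].
  - by apply/forall_inP => x /(fintype.subsetP D'D)/(forall_inP DQ).
  - apply/forall_inP => x; rewrite inE => /andP[_ /exists_inP[y yQ xy]].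
    apply/forall_inP => z zJ; apply/implyP => zx; rewrite inE zJ.
    by apply/exists_inP; exists y => //; apply: le_trans zx xy.
  - apply: le_trans pI' _; apply/joinsP => q qI'; apply: joins_sup.
    by rewrite inE (fintype.subsetP I'J) //=; apply/exists_inP; exists q.
apply/fintype.subsetP => x xI; have := IDs _ xI; rewrite -D'E inE.
case/andP=> _ /exists_inP[y yI' xy]; have [z zI yz] := I'I _ yI'.
by rewrite (maxI x y) //; apply: down (IDs _ zI) (fintype.subsetP I'J _ yI') yz.
Qed.

(** The existence of [t] for every [p] is the lower boundedness of the evaluation homomorphism from
    the free lattice on [K] to [K]. *)
Definition least_preimage (p : K) (t : lterm K) : Prop :=
  p <= lterm_eval id t /\ forall s, p <= lterm_eval id s -> lterm_le t s.

Lemma least_preimage_eval p t : least_preimage p t -> lterm_eval id t = p.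
Proof.
move=> [pt tmin]; apply/le_anti; rewrite pt andbT.
exact: (lterm_eval_le id (tmin (LVar p) (lexx p))).
Qed.

(** The term [t] lies below the join of the least preimages [T q] of the members [q] of [I]; by
    minimality of the pair, a refinement of this cover by subterms of [t] contains a least preimage
    of [i]. *)
Lemma minimal_pair_subterm p I i t : minimal_pair p I -> i \in I ->
  least_preimage p t -> (forall q, q \in J -> exists s, least_preimage q s) ->
  exists2 u, least_preimage i u & (lsize u < lsize t)%N.
Proof.
move=> mp iI tp lp; have [pJ IJ pNI pI Imin] := mp.
have /choice[T TP] q : exists s, q \in J -> least_preimage q s.
  by have [/lp[s ?]|] := boolP (q \in J); [exists s|exists (LVar p)].
have {}TP q : q \in I -> least_preimage q (T q) by move/(fintype.subsetP IJ)/TP.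
pose V := [seq T q | q in I].
have tV : lterm_le t (ljoin (T i) V).
  case: tp => _; apply; apply: le_trans pI _; apply/joinsP => q qI.
  apply: le_trans (TP _ qI).1 _; apply: lterm_eval_le; apply: lterm_le_ljoin.
  by rewrite in_cons; apply/orP; right; apply/fintype.imageP; exists q.
have [U [US UL]] := ljoin_cover_refine id tV.
have {}US u : u \in U -> lsubterm u t /\ exists2 q, q \in I & lterm_le u (T q).
  move=> /US[us [w wV uw]]; split=> //; move: wV.
  rewrite in_cons => /orP[/eqP wE|/fintype.imageP[q qI wE]]; [exists i|exists q] => //;
    by rewrite -wE.
(* [I'] refines [I] and covers [p], so [i] is below the value of some [u] in [U]. *)
pose I' := [set x in J | [exists u : 'I_(size U), x <= lterm_eval id (nth t U u)]].
have /fintype.subsetP/(_ i iI) : I \subset I'.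
  apply: Imin; first by apply/fintype.subsetP => x; rewrite inE => /andP[].
    move=> x; rewrite inE => /andP[_ /existsP[u xu]].
    have [_ [q qI uq]] := US _ (mem_nth t (ltn_ord u)); exists q => //.
    by rewrite -(least_preimage_eval (TP _ qI)) (le_trans xu) // lterm_eval_le.
  rewrite -(least_preimage_eval tp); apply: UL => u uU; apply: ji_le => x xJ xu.
  apply: joins_sup; rewrite inE xJ; apply/existsP.
  have uN : (index u U < size U)%N by rewrite index_mem.
  by exists (Ordinal uN); rewrite /= nth_index.
rewrite inE => /andP[_ /existsP[k]]; set u := nth t U k => iu.
have [us [q qI uq]] := US _ (mem_nth t (ltn_ord k)).
have uq' : lterm_eval id u <= q.
  by rewrite -(least_preimage_eval (TP _ qI)) lterm_eval_le.
(* Since [I] is an antichain, [u] lies below [T i] and inherits its minimality. *)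
have iq : i = q by apply: (minimal_pair_antichain mp) => //; apply: le_trans iu uq'.
exists u.
  split=> // s si; apply: lterm_le_trans uq _; rewrite -iq.
  by have [_ ] := TP _ iI; apply.
(* Were [u] equal to [t], its value would be both [p] and [i], but [p] is not in [I]. *)
have [ut|//] := lsubterm_size us; case/negP: pNI.
have ep := least_preimage_eval tp.
suff -> : p = i by [].
by apply/le_anti; rewrite -ep -/u -ut iu andbT iq.
Qed.

(* [p] is ranked by the least size of a term that represents its least preimage. *)
Theorem T_join_least_preimage :
  (forall p, p \in J -> exists t, least_preimage p t) -> T_join K.
Proof.
move=> lp.
have /choice[m mP] p : exists n, p \in J ->
    (exists2 t, least_preimage p t & lsize t = n) /\
    forall t, least_preimage p t -> (n <= lsize t)%N.
  have [/lp[t tp]|] := boolP (p \in J); last by exists 0%N.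
  have ex : exists n, `[< exists2 t, least_preimage p t & lsize t = n >].
    by exists (lsize t); apply/asboolP; exists t.
  exists (ex_minn ex) => _; case: ex_minnP => n /asboolP np nmin; split=> // s sp.
  by apply: nmin; apply/asboolP; exists s.
(* Larger ranks come first; ties are broken by the enumeration of [K], for antisymmetry. *)
exists (fun p q => (m q < m p)%N ||
  (m q == m p) && (enum_rank q <= enum_rank p)%N); split; last first.
  move=> p I mp i iI; have [pJ IJ _ _ _] := mp.
  have [[t tp tm] _] := mP _ pJ; have [_ imin] := mP _ (fintype.subsetP IJ _ iI).
  have [u ui ut] := minimal_pair_subterm mp iI tp lp.
  by rewrite -tm (leq_ltn_trans (imin _ ui) ut).
split.
- by move=> p _; rewrite eqxx leqnn orbT.
- move=> p q _ _ /andP[].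
  case: ltngtP => //= _ qp pq; apply/enum_rank_inj/val_inj/eqP.
  by rewrite eqn_leq qp pq.
- move=> q p s _ _ _ /orP[qp|/andP[/eqP-> qp]] /orP[sq|/andP[/eqP -> sq]].
  + by rewrite (ltn_trans sq qp).
  + by rewrite qp.
  + by rewrite sq.
  + by rewrite eqxx (leq_trans sq qp) orbT.
- move=> p q _ _; case: ltngtP => //= _.
  exact: leq_total.
Qed.

End FiniteLattice.

(** * Tensor products *)

Section Tensor.
Context (dA dB : Order.disp_t) (A : bLatticeType dA) (B : bLatticeType dB).
Implicit Types (I : biideal A B) (s : seq (A * B)).
Local Open Scope classical_set_scope.

Lemma biidealP I : is_biideal I.
Proof. by apply/asboolP; exact: biideal_setP. Qed.

Lemma le_biidealP I I' : I <= I' <-> (biideal_set I `<=` biideal_set I').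
Proof. by rewrite biideal_leE; split=> /asboolP. Qed.

Lemma pure_leP (S : set (A * B)) a b : is_biideal S -> (pure_set a b `<=` S) <-> S (a, b).
Proof.
move=> bS; split=> [|Sab]; first by apply; right.
move=> [x y] [|[/= xa yb]]; first exact: biideal_bot.
exact: (biideal_down bS xa yb).
Qed.

Lemma biideal_setI (S S' : set (A * B)) :
  is_biideal S -> is_biideal S' -> is_biideal (S `&` S').
Proof.
move=> bS bS'; split.
- move=> a b a' b' aa' bb' [? ?]; split.
    exact: (biideal_down bS aa' bb').
  exact: (biideal_down bS' aa' bb').
- by move=> p tp; split; apply: biideal_bot.
- by move=> a b0 b1 [? ?] [? ?]; split; apply: biideal_joinr.
- by move=> a0 a1 b [? ?] [? ?]; split; apply: biideal_joinl.
Qed.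

(** An impredicative form of generation: to bound the members, it suffices to exhibit one bi-ideal
    [S] that contains [s]. *)
Definition span_set s : set (A * B) :=
  [set p | forall S, is_biideal S -> {in s, forall q, S q} -> S p].

Lemma span_set_biideal s : is_biideal (span_set s).
Proof.
split.
- by move=> a b a' b' aa' bb' ab S bS sS; apply: (biideal_down bS aa' bb'); exact: ab.
- by move=> p tp S bS _; apply: biideal_bot.
- by move=> a b0 b1 h0 h1 S bS sS; apply: (biideal_joinr bS); [exact: h0|exact: h1].
- by move=> a0 a1 b h0 h1 S bS sS; apply: (biideal_joinl bS); [exact: h0|exact: h1].
Qed.

Lemma mem_span s p : p \in s -> span_set s p.
Proof. by move=> ps S _; apply. Qed.

Definition span_biideal s : biideal A B := Biideal (asboolT (span_set_biideal s)).

Lemma supremums_pureP s I :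
  supremums [set pure p.1 p.2 | p in [set` s]] I <-> biideal_set I = span_set s.
Proof.
have pleP p (I' : biideal A B) : pure p.1 p.2 <= I' <-> biideal_set I' p.
  by rewrite le_biidealP (pure_leP _ _ (biidealP I')); case: p.
have ubP I' : ubound [set pure p.1 p.2 | p in [set` s]] I' <->
    {in s, forall p, biideal_set I' p}.
  split=> [ub p ps|sI _ [p ps <-]]; last by apply/pleP; exact: sI.
  by apply/pleP; apply: ub; exists p.
split=> [[/ubP sI leI]|IE].
  apply/seteqP; split=> [p Ip S bS sS|p]; last by apply=> //; exact: biidealP.
  have /le_biidealP/(_ p Ip) // : I <= Biideal (asboolT bS).
  by apply: leI; apply/ubP.
split; first by apply/ubP => p ps; rewrite IE; exact: mem_span.
by move=> I' /ubP sI'; apply/le_biidealP => p; rewrite IE; apply=> //; exact: biidealP.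
Qed.

Fact span_fin_join_pure s : fin_join_pure (span_biideal s).
Proof. by exists s; apply/supremums_pureP. Qed.

Definition span s : (A ⊗ B)%type := Tensor (asboolT (span_fin_join_pure s)).

Lemma tensorP (I : (A ⊗ B)%type) : exists s, biideal_set I = span_set s.
Proof.
have /asboolP [s] := tensor_biidealP I; exists s; exact/supremums_pureP.
Qed.

Lemma le_tensorP (I I' : (A ⊗ B)%type) : I <= I' <-> (biideal_set I `<=` biideal_set I').
Proof. by rewrite -le_biidealP. Qed.

Lemma span_min s (S : set (A * B)) :
  is_biideal S -> {in s, forall q, S q} -> span_set s `<=` S.
Proof. by move=> bS sS p; apply. Qed.

Lemma bigcup_pure s p : (\bigcup_(q in [set` s]) pure_set q.1 q.2) p <->
  exists2 q, q \in s & pure_set q.1 q.2 p.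
Proof. by split=> -[q]; exists q. Qed.

(** The join is generated by the generators of both. The intersection of two finite unions of pure
    tensors is the union of the pairwise intersections, which are pure tensors; it is thus
    compact. *)
Lemma capped_is_lattice : capped A B -> is_lattice (A ⊗ B)%type.
Proof.
move=> cap I I'; have [s Is] := tensorP I; have [s' Is'] := tensorP I'.
split.
  exists (span (s ++ s')); split.
    move=> _ [->|->]; apply/le_tensorP; rewrite (Is, Is'); apply: span_min;
      by [exact: span_set_biideal|move=> q qs; apply: mem_span; rewrite mem_cat qs ?orbT].
  move=> T ub; apply/le_tensorP; apply: span_min; first exact: biidealP.
  move=> q; rewrite mem_cat => /orP[qs|qs].
    have /le_tensorP : I <= T by apply: ub; left.
    by apply; rewrite Is; exact: mem_span.
  have /le_tensorP : I' <= T by apply: ub; right.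
  by apply; rewrite Is'; exact: mem_span.
have [t It] := cap I; have [t' It'] := cap I'.
pose m := [seq (Order.meet p.1 q.1, Order.meet p.2 q.2) | p <- t, q <- t'].
have sub p : biideal_set (span m) p -> biideal_set I p /\ biideal_set I' p.
  apply: (@span_min _ (biideal_set I `&` biideal_set I')).
    by apply: biideal_setI; exact: biidealP.
  move=> _ /allpairsP[[q q'] /= [qt qt' ->]]; split.
    apply: (@biideal_down _ _ _ _ _ (biidealP I) _ _ q.1 q.2); rewrite ?leIl //.
    by rewrite It bigcup_pure; exists q => //; right.
  apply: (@biideal_down _ _ _ _ _ (biidealP I') _ _ q'.1 q'.2); rewrite ?leIr //.
  by rewrite It' bigcup_pure; exists q' => //; right.
exists (span m); split.
  by move=> _ [->|->]; apply/le_tensorP => p /sub[].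
move=> T lb; apply/le_tensorP => p Tp.
have : biideal_set I p.
  by have /le_tensorP : T <= I by [apply: lb; left]; apply.
have : biideal_set I' p.
  by have /le_tensorP : T <= I' by [apply: lb; right]; apply.
rewrite It It' !bigcup_pure => -[q' qt'] + [q qt].
have bot : tbot p -> span_set m p by apply: biideal_bot; exact: span_set_biideal.
case=> [/bot//|[pq1' pq2']] [/bot//|[pq1 pq2]].
case: p pq1' pq2' pq1 pq2 {Tp bot} => /= x y *.
apply: (@biideal_down _ _ _ _ _ (span_set_biideal m) _ _
  (Order.meet q.1 q'.1) (Order.meet q.2 q'.2)).
- by rewrite lexI; apply/andP.
- by rewrite lexI; apply/andP.
by apply: mem_span; apply/allpairsP; exists (q, q').
Qed.

End Tensor.

(** * Amenability implies local finiteness *)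

Section DualWithBottom.
Context (d : Order.disp_t) (A : latticeType d).

(** [A] may lack a greatest element, and its order dual a zero; [None] supplies one. *)
Definition dual_bot : Type := option A.
HB.instance Definition _ := Choice.copy dual_bot (option A).

Definition dual_bot_le (x y : dual_bot) : bool :=
  match x, y with Some a, Some b => b <= a | None, _ => true | _, None => false end.
Definition dual_bot_meet (x y : dual_bot) : dual_bot :=
  if x is Some a then if y is Some b then Some (a `|` b) else None else None.
Definition dual_bot_join (x y : dual_bot) : dual_bot :=
  match x, y with Some a, Some b => Some (a `&` b) | None, _ => y | _, None => x end.

Fact dual_bot_refl : reflexive dual_bot_le.
Proof. by case=> /=. Qed.
Fact dual_bot_anti : antisymmetric dual_bot_le.
Proof. by move=> [a|] [b|] //= ?; congr Some; apply/le_anti; rewrite andbC. Qed.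
Fact dual_bot_trans : transitive dual_bot_le.
Proof. by move=> [a|] [b|] [c|] //= ab bc; apply: le_trans ab. Qed.
HB.instance Definition _ :=
  Order.Le_isPOrder.Build d dual_bot dual_bot_refl dual_bot_anti dual_bot_trans.

Fact dual_bot_lexI (x y z : dual_bot) :
  (x <= dual_bot_meet y z) = (x <= y) && (x <= z).
Proof. by case: x y z => [a|] [b|] [c|] //=; rewrite ?andbF //; exact: leUx. Qed.
Fact dual_bot_leUx (x y z : dual_bot) :
  (dual_bot_join x y <= z) = (x <= z) && (y <= z).
Proof. by case: x y z => [a|] [b|] [c|] //=; rewrite ?andbT //; exact: lexI. Qed.
HB.instance Definition _ := Order.POrder_isMeetSemilattice.Build d dual_bot dual_bot_lexI.
HB.instance Definition _ := Order.POrder_isJoinSemilattice.Build d dual_bot dual_bot_leUx.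

Fact dual_bot_le0x (x : dual_bot) : (None : dual_bot) <= x.
Proof. by []. Qed.
HB.instance Definition _ := Order.hasBottom.Build d dual_bot dual_bot_le0x.

End DualWithBottom.

(* The bi-ideal generated in [A × A^dual] by the pairs [(x, x)], for [x] in [X],
   contains the diagonal of the sublattice generated by [X], and each of its
   members is below a point of this diagonal.  Hence the pure tensor of a cap that
   contains [(g, g)] is [g ⊗ g]. *)
Lemma amenable_locally_finite d (A : bLatticeType d) : amenable A -> locally_finite A.
Proof.
move=> am X /finite_seqP[s Xs]; set G := smallest _ X.
have Gsub : is_sublattice G.
  by move=> x y Gx Gy; split=> S [Ssub XS];
    have [] := Ssub x y (Gx S (conj Ssub XS)) (Gy S (conj Ssub XS)).
have XG x : X x -> G x by move=> Xx S [_]; apply.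
pose I := span [seq (x, Some x : dual_bot A) | x <- s].
have IP a v : biideal_set I (a, v) -> [\/ a = \bot, v = None |
    exists g b, [/\ G g, v = Some b, a <= g & g <= b]].
  (* Apart from zero coordinates, these are the pairs with a member of [G] between them; lateral
     joins replace two such members by their meet or their join. *)
  pose S : set (A * dual_bot A) := [set p | [\/ p.1 = \bot, p.2 = None |
    exists g b, [/\ G g, p.2 = Some b, p.1 <= g & g <= b]]]%classic.
  suff : (span_set [seq (x, Some x : dual_bot A) | x <- s] `<=` S)%classic by apply.
  apply: span_min; last first.
    move=> _ /mapP[x xs ->]; constructor 3; exists x, x; split=> //.
    by apply: XG; rewrite Xs.
  split.
  - move=> a' [b'|] a'' b'' aa bb; last by constructor 2.
    case=> /= [a0|b0|[g [b [Gg b''E ag gb]]]].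
    + by constructor 1; apply/eqP; rewrite -lex0 -a0.
    + by move: bb; rewrite b0.
    + constructor 3; exists g, b'; split=> //; first exact: le_trans ag.
      by move: bb; rewrite b''E; exact: (le_trans gb).
  - by move=> p [|]; [constructor 1|constructor 2].
  - move=> a' b0 b1 [/= ->|/= ->|/= [g [b [Gg -> ag gb]]]]; [by constructor 1|by []|].
    case=> [/= ->|/= ->|/= [g' [b' [Gg' -> ag' gb']]]]; first by constructor 1.
      by constructor 3; exists g, b.
    constructor 3; exists (g `&` g'), (b `&` b'); split=> //=.
    + by have [] := Gsub _ _ Gg Gg'.
    + by rewrite lexI ag ag'.
    + by rewrite leI2.
  - move=> a0 a1 b [/= ->|/= ->|/= [g [c [Gg -> ag gb]]]].
    + by rewrite join0x.
    + by constructor 2.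
    + case=> [/= ->|//|/= [g' [c' [Gg' [<-] ag' gb']]]].
        by rewrite joinx0; constructor 3; exists g, c.
      constructor 3; exists (g `|` g'), c; split=> //=.
      * by have [] := Gsub _ _ Gg Gg'.
      * by rewrite leU2.
      * by rewrite leUx gb gb'.
have GI g : G g -> biideal_set I (g, Some g).
  pose S : set A := [set x | biideal_set I (x, Some x)]%classic.
  move=> /(_ S); apply; split; last first.
    by move=> x; rewrite Xs => xs; apply: mem_span; apply/mapP; exists x.
  have bI := biidealP I.
  move=> x y Sx Sy; split; red => /=.
    have -> : Some (x `&` y) = (Some x : dual_bot A) `|` Some y by [].
    apply: (biideal_joinr bI).
      by apply: (biideal_down bI _ _ Sx); rewrite ?leIl.
    by apply: (biideal_down bI _ _ Sy); rewrite ?leIr.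
  apply: (biideal_joinl bI).
    by apply: (biideal_down bI _ _ Sx); rewrite //; exact: leUl.
  by apply: (biideal_down bI _ _ Sy); rewrite //; exact: leUr.
have [t It] := am _ _ I.
apply: (@sub_finite_set _ _ [set` (\bot :: [seq p.1 | p <- t])]%classic);
  last exact: finite_seq.
move=> g Gg; rewrite /= in_cons; apply/orP; have := GI g Gg.
rewrite It bigcup_pure => -[[a v] pt].
case=> [[/= ->|//]|/= [ga gv]]; first by left.
right; apply/mapP; exists (a, v) => //=.
have : biideal_set I (a, v) by rewrite It bigcup_pure; exists (a, v) => //; right.
case/IP=> [a0|v0|[h [b [Gh vb ah hb]]]].
- by apply/le_anti; rewrite ga a0 le0x.
- by move: gv; rewrite v0.
- apply/le_anti; rewrite ga (le_trans ah) // (le_trans hb) //.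
  by move: gv; rewrite vb.
Qed.

(** * From lattices to the condition T *)

Section LatticeF3.
Context (d : Order.disp_t) (A : bLatticeType d) (K : fin_sublattice A).
Implicit Types (t u : lterm K).
Local Notation J := (join_irreducibles K).

Lemma fsl_valI (x y : K) : val (x `&` y) = val x `&` val y.
Proof. by []. Qed.

Lemma fsl_valU (x y : K) : val (x `|` y) = val x `|` val y.
Proof. by []. Qed.

Lemma F3_lex1 (v : F3) : v <= F3_gen (inord 0) `|` F3_gen (inord 1) `|` F3_gen (inord 2).
Proof.
elim/free_ind: v => [i|v w vle _|v w vle wle]; last 2 first.
- by rewrite leIx2 // vle.
- by rewrite leUx vle.
have: i = inord i by rewrite inord_val.
case: i => -[|[|[|[]]]] // /= _ ->; rewrite -/(F3_gen _).
- by rewrite -joinA leUl.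
- by rewrite joinAC leUr.
- by rewrite leUr.
Qed.

(* In [H = ⋁ (k ⊗ E k)], the section at [ev t] contains the dual of [t], evaluated
   at [E].  Meeting [H] with [p ⊗ 1] makes the section of [H] at [p] principal,
   because [p] is join-irreducible in [K]. *)
Lemma lattice_tensor_F3_least_preimage : is_lattice (A ⊗ F3)%type ->
  forall p : K, p \in J -> exists t, least_preimage p t.
Proof.
move=> latA p /jiP[p0 pJ].
have [x xE] := lterm_I3_embedding (\bot : K).
pose E (k : K) : F3 := (\pi_(free_lattice 'I_3) (x k))%qT.
pose Ed t : F3 := lterm_eval E (ldual t).
(* As [x] is an embedding, [Ed] reflects the order of terms, reversed. *)
have Ed_le t u : Ed t <= Ed u -> lterm_le u t.
  rewrite /Ed /E !(lterm_eval_free x) free_leE => /asboolP /xE /ldual_le.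
  by rewrite !ldualK.
pose ev t : A := val (lterm_eval id t).
have evI t u : ev (LMeet t u) = ev t `&` ev u by [].
have evU t u : ev (LJoin t u) = ev t `|` ev u by [].
pose H := span [seq (val k, E k) | k <- enum K].
have HE t : biideal_set H (ev t, Ed t).
  have bH := biidealP H.
  elim: t => [k|t IHt u IHu|t IHt u IHu].
  - by apply: mem_span; apply/mapP; exists k; rewrite ?mem_enum.
  - apply: (biideal_joinr bH).
      by apply: (biideal_down bH _ _ IHt); rewrite ?evI ?leIl.
    by apply: (biideal_down bH _ _ IHu); rewrite ?evI ?leIr.
  - rewrite evU; apply: (biideal_joinl bH).
      by apply: (biideal_down bH _ _ IHt); rewrite /Ed /= ?leIl.
    by apply: (biideal_down bH _ _ IHu); rewrite /Ed /= ?leIr.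
have HP (u : A) (v : F3) : biideal_set H (u, v) -> [\/ u = \bot, v = \bot |
    exists2 t, u <= ev t & v <= Ed t].
  pose S : set (A * F3) := [set q | [\/ q.1 = \bot, q.2 = \bot |
    exists2 t, q.1 <= ev t & q.2 <= Ed t]]%classic.
  suff : (span_set [seq (val k, E k) | k <- enum K] `<=` S)%classic by apply.
  apply: span_min; last first.
    by move=> _ /mapP[k _ ->]; constructor 3; exists (LVar k).
  split.
  - move=> a b a' b' aa bb [/= a0|/= b0|/= [t at_ bt]].
    + by constructor 1; apply/eqP; rewrite -lex0 -a0.
    + by constructor 2; apply/eqP; rewrite -lex0 -b0.
    + by constructor 3; exists t; [exact: le_trans at_|exact: le_trans bt].
  - by move=> q [|]; [constructor 1|constructor 2].
  - move=> a b0 b1 [/= ->|/= ->|/= [t at_ bt]]; [by constructor 1|by rewrite join0x|].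
    case=> [/= ->|/= ->|/= [t' at' bt']]; first by constructor 1.
      by rewrite joinx0; constructor 3; exists t.
    constructor 3; exists (LMeet t t') => /=.
      by rewrite evI lexI at_ at'.
    by rewrite leU2.
  - move=> a0 a1 b [/= ->|/= ->|/= [t at_ bt]]; [by rewrite join0x|by constructor 2|].
    case=> [/= ->|/= ->|/= [t' at' bt']]; last first.
    + constructor 3; exists (LJoin t t') => /=.
        by rewrite evU leU2.
      by rewrite /Ed /= lexI bt bt'.
    + by constructor 2.
    + by rewrite joinx0; constructor 3; exists t.
pose top3 := F3_gen (inord 0) `|` F3_gen (inord 1) `|` F3_gen (inord 2).
have [_ [G [Glb Gglb]]] := latA H (span [:: (val p, top3)]).
have [s Gs] := tensorP G.
have GH q : q \in s -> biideal_set H q /\ pure_set (val p) top3 q.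
  move=> qs; have Gq : biideal_set G q by rewrite Gs; exact: mem_span.
  have /le_tensorP GH : G <= H by apply: Glb; left.
  have /le_tensorP Gp : G <= span [:: (val p, top3)] by apply: Glb; right.
  split; first exact: GH.
  apply: (span_min _ _ (Gp _ Gq)); first exact: pure_set_biideal.
  by move=> q'; rewrite inE => /eqP ->; right.
(* The infimum [G] contains every pure tensor below both bi-ideals, so it has the same section at
   [p] as [H]. *)
have HG v : biideal_set H (val p, v) -> biideal_set G (val p, v).
  move=> Hv; have /le_tensorP : span [:: (val p, v)] <= G.
    apply: Gglb => _ [->|->]; apply/le_tensorP; apply: span_min.
    - exact: biidealP.
    - by move=> q; rewrite inE => /eqP->.
    - exact: biidealP.
    - move=> q; rewrite inE => /eqP->.
      apply: (biideal_down (biidealP _) (lexx _) (F3_lex1 v)).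
      by apply: mem_span; rewrite inE.
  by apply; apply: mem_span; rewrite inE.
have /choice[T TP] (q : A * F3) : exists t, q \in s -> q.1 <> \bot ->
    q.2 <> \bot -> q.1 <= ev t /\ q.2 <= Ed t.
  case: q => a b.
  have [/GH[/HP[a0|b0|[t at_ bt]] _]|_] := boolP ((a, b) \in s); last by exists (LVar p).
  - by exists (LVar p).
  - by exists (LVar p).
  - by exists t.
pose r := [seq T q | q <- s & p <= lterm_eval id (T q)].
(* The meet of the terms of those generators of [G] that reach [p]. It starts at [LVar p], whose
   value is [p], so that an empty [r] is allowed. *)
pose t0 := foldr (@LMeet K) (LVar p) r.
have pt0 : p <= lterm_eval id t0.
  have : {in r, forall t, p <= lterm_eval id t}.
    by move=> _ /mapP[q + ->]; rewrite mem_filter => /andP[].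
  rewrite /t0; elim: {t0} r => //= t r IH rp; rewrite lexI rp ?mem_head //=.
  by apply: IH => u ur; apply: rp; rewrite in_cons ur orbT.
have t0r t : t \in r -> lterm_le t0 t.
  rewrite /t0; elim: {t0 pt0} r => //= u r IH; rewrite in_cons => /predU1P[->|/IH le].
    exact: lterm_leIl.
  by apply: lterm_le_trans le; exact: lterm_leIr.
exists t0; split=> // u pu; apply: Ed_le.
(* A bi-ideal containing [G] whose section at [p] is bounded by [Ed t0]. The second coordinate is
   free when [k < p]; closure under joins of first coordinates therefore rests on the
   join-irreducibility of [p]. *)
pose S : set (A * F3) := [set q | [\/ q.1 = \bot, q.2 = \bot |
  exists k : K, [/\ q.1 <= val k, k <= p & p <= k -> q.2 <= Ed t0]]]%classic.
have : S (val p, Ed u).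
  have : (span_set s `<=` S)%classic.
    apply: span_min; last first.
      move=> q qs; have [q1|q1] := eqVneq q.1 \bot; first by constructor 1.
      have [q2|q2] := eqVneq q.2 \bot; first by constructor 2.
      have [_ [[/eqP|/eqP]|[/= qp _]]] := GH _ qs; [by rewrite (negPf q1)|by rewrite (negPf q2)|].
      have [qT1 qT2] := TP _ qs (elimN eqP q1) (elimN eqP q2).
      constructor 3; exists (lterm_eval id (T q) `&` p); split.
      + by rewrite fsl_valI lexI qT1.
      + exact: leIr.
      + rewrite lexI lexx andbT => pT; apply: le_trans qT2 _.
        apply: lterm_eval_le; apply: ldual_le; apply: t0r.
        by apply/mapP; exists q; rewrite // mem_filter pT.
    split.
    - move=> a b a' b' aa bb [/= a0|/= b0|/= [k [ak kp kb]]].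
      + by constructor 1; apply/eqP; rewrite -lex0 -a0.
      + by constructor 2; apply/eqP; rewrite -lex0 -b0.
      + constructor 3; exists k; split=> //= [|pk]; first exact: le_trans ak.
        exact: le_trans (kb pk).
    - by move=> q [|]; [constructor 1|constructor 2].
    - move=> a b0 b1 [/= ->|/= ->|/= [k [ak kp kb]]]; [by constructor 1|by rewrite join0x|].
      case=> [/= ->|/= ->|/= [k' [ak' kp' kb']]]; first by constructor 1.
        by rewrite joinx0; constructor 3; exists k.
      constructor 3; exists (k `&` k'); split.
      + by rewrite fsl_valI lexI /= ak ak'.
      + by rewrite leIx2 ?kp.
      + by rewrite lexI leUx => /andP[/kb-> /kb'->].
    - move=> a0 a1 b [/= ->|/= ->|/= [k [ak kp kb]]]; [by rewrite join0x|by constructor 2|].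
      case=> [/= ->|/= ->|/= [k' [ak' kp' kb']]].
      + by rewrite joinx0; constructor 3; exists k.
      + by constructor 2.
      constructor 3; exists (k `|` k'); split=> [||pk].
      + by rewrite fsl_valU leU2.
      + by rewrite leUx kp kp'.
      have /pJ[pE|pE] : p = k `|` k' by apply/le_anti; rewrite pk leUx kp kp'.
        by apply: kb; rewrite -pE.
      by apply: kb'; rewrite -pE.
  apply; rewrite -Gs; apply: HG; apply: (biideal_down (biidealP H) _ (lexx _) (HE u)).
  by rewrite /ev leEsub in pu *.
case=> [/= pbot|/= ->|/= [k [pk _ kt]]].
(* The zero of [A] may lie outside [K], but [val p = \bot] would make [p] the least element of
   [K]. *)
- case/eqP: p0; apply/le_anti; rewrite le0x andbT.
  have h : val p <= val (\bot : K) by rewrite /= pbot le0x.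
  exact: h.
- exact: le0x.
- exact: kt pk.
Qed.

Lemma lattice_tensor_F3_T_join : is_lattice (A ⊗ F3)%type -> T_join K.
Proof. by move=> /lattice_tensor_F3_least_preimage /T_join_least_preimage. Qed.

End LatticeF3.

(** * From the condition T to capped tensor products *)

Lemma le_bigmeet d (L : latticeType d) (T : Type) (r : seq T) (P : pred T)
    (f : T -> L) (u v : L) :
  (v <= \big[Order.meet/u]_(i <- r | P i) f i) =
  (v <= u) && all (fun i => P i ==> (v <= f i)) r.
Proof.
elim: r => [|i r IH]; first by rewrite big_nil andbT.
by rewrite big_cons /=; case: (P i) => //=; rewrite lexI IH andbCA.
Qed.

Lemma le_bigmeetP d (L : latticeType d) (T : finType) (P : pred T)
    (f : T -> L) (u v : L) :
  reflect (v <= u /\ forall i, P i -> v <= f i) (v <= \big[Order.meet/u]_(i | P i) f i).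
Proof.
rewrite le_bigmeet; apply: (iffP andP) => -[vu vf]; split=> //.
  by move=> i; apply/implyP; apply: (allP vf); rewrite mem_index_enum.
by apply/allP => i _; apply/implyP; exact: vf.
Qed.

(** The rank counts the elements of [J] strictly after [p] in the linear order; it drops from [p] to
    [i] because [p] strictly precedes [i]. *)
Lemma T_join_rank d (K : finTBLatticeType d) : T_join K ->
  exists rank : K -> nat, forall p I, minimal_pair p I ->
    forall i, i \in I -> (rank i < rank p)%N.
Proof.
move=> [r [[_ ranti rtrans _] rT]].
exists (fun p => #|[set q in join_irreducibles K | r p q && (q != p)]%SET|).
move=> p I mp i iI; have pi := rT _ _ mp _ iI.
have [pJ IJ pNI _ _] := mp; have iJ := fintype.subsetP IJ _ iI.
have i_p : i != p by apply: contraNneq pNI => <-.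
apply: proper_card; apply/fintype.properP; split; last first.
  by exists i; [rewrite inE iJ pi i_p|rewrite inE eqxx !andbF].
apply/fintype.subsetP => q; rewrite inE => /andP[qJ /andP[iq _]].
rewrite inE qJ (rtrans i p q) //=; apply: contraNneq i_p => qp.
by apply/eqP/ranti; rewrite // pi andbT -qp.
Qed.

(** * The fixpoint equation over minimal pairs *)

Section Stabilization.
Context (dK dL : Order.disp_t) (K : finTBLatticeType dK) (L : bLatticeType dL).
Context (u : L) (f0 : K -> L).
Implicit Types (f : K -> L) (p q : K) (I Q : {set K}).
Local Notation J := (join_irreducibles K).

(* [L] may have no top: the bound [u] stands for the empty meet. *)
Definition minimal_pair_step f p : L :=
  f0 p `|` \join_(I : {set K} | `[< minimal_pair p I >]) \big[Order.meet/u]_(i in I) f i.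

Lemma minimal_pair_step_eq f f' p :
  (forall I i, minimal_pair p I -> i \in I -> f i = f' i) ->
  minimal_pair_step f p = minimal_pair_step f' p.
Proof.
move=> ff'; congr (_ `|` _); apply: eq_bigr => I /asboolP mp.
by apply: eq_bigr => i iI; exact: ff' mp iI.
Qed.

(** The value at [p] depends only on values of lower rank, so it is stable after [rank p + 1]
    iterations; one more than the largest rank serves all [p]. *)
Lemma minimal_pair_step_fixpoint (rank : K -> nat) :
  (forall p I, minimal_pair p I -> forall i, i \in I -> (rank i < rank p)%N) ->
  exists f, forall p, f p = minimal_pair_step f p.
Proof.
move=> rankP; pose F n := iter n minimal_pair_step f0.
have stab n p : (rank p < n)%N -> F n p = F n.+1 p.
  elim: n p => // n IH p; rewrite ltnS => pn.
  apply: minimal_pair_step_eq => I i mp iI; apply: IH.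
  exact: leq_trans (rankP _ _ mp _ iI) pn.
exists (F (\max_p rank p).+1) => p; apply: stab.
by rewrite ltnS; exact: leq_bigmax.
Qed.

Section FixpointCover.
Context (f : K -> L) (fE : forall p, f p = minimal_pair_step f p).

(** The cover refines to a set that contains [p] or forms a minimal pair with it; in the second case
    the equation for [f p] applies. Antitonicity is assumed only on [Q], so that the lemma serves in
    the induction of [fixpoint_anti]. *)
Lemma fixpoint_join_cover p Q v :
  p \in J -> Q \subset J -> p <= \join_(q in Q) q ->
  (forall q x, q \in Q -> x \in J -> x <= q -> f q <= f x) ->
  (forall q, q \in Q -> v <= f q) -> v <= u -> v <= f p.
Proof.
move=> pJ QJ pQ anti vQ vu.
have [I [IJ IQ _ [/IQ[q qQ pq]|mp]]] := join_cover_refine pJ QJ pQ.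
  exact: le_trans (vQ _ qQ) (anti _ _ qQ pJ pq).
rewrite fE; apply: lexU2; apply/orP; right.
apply: (le_trans _ (joins_sup _ _)); last exact/asboolP/mp.
apply/le_bigmeetP; split=> // i iI; have [q qQ iq] := IQ _ iI.
exact: le_trans (vQ _ qQ) (anti _ _ qQ (fintype.subsetP IJ _ iI) iq).
Qed.

Hypothesis f0_anti : {homo f0 : x y / x <= y >-> y <= x}.
Hypothesis f0_u : forall p, f0 p <= u.

(** Induction on the rank of [q]: for a minimal pair [(q, I)], the set [I] also covers [p], and its
    members have lower rank than [q]. *)
Lemma fixpoint_anti (rank : K -> nat) :
  (forall p I, minimal_pair p I -> forall i, i \in I -> (rank i < rank p)%N) ->
  {in J &, forall p q, p <= q -> f q <= f p}.
Proof.
move=> rankP p q + qJ; have [n] := ubnP (rank q).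
elim: n => // n IH in p q qJ * => /ltnSE qn pJ pq.
rewrite fE leUx; apply/andP; split.
  by apply: le_trans (f0_anti pq) _; rewrite fE leUl.
apply/joinsP => I /asboolP mp; have [_ IJ _ qI _] := mp.
apply: (fixpoint_join_cover pJ IJ (le_trans pq qI)).
- move=> i x iI xJ xi; apply: IH xJ xi; first exact: (fintype.subsetP IJ).
  exact: leq_trans (rankP _ _ mp _ iI) qn.
- by move=> i iI; have /le_bigmeetP[_] := lexx (\big[Order.meet/u]_(i in I) f i); apply.
- by have /le_bigmeetP[] := lexx (\big[Order.meet/u]_(i in I) f i).
Qed.

End FixpointCover.
End Stabilization.

(** * Caps of finitely generated bi-ideals *)

Section Capped.
Context (d dL : Order.disp_t) (A : bLatticeType d) (L : bLatticeType dL).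
Context (K : fin_sublattice A).
Implicit Types (k p : K).
Local Notation J := (join_irreducibles K).

Lemma T_join_span_capped (s : seq (A * L)) : T_join K ->
  \bot \in fsl_carrier K -> (forall q, q \in s -> q.1 \in fsl_carrier K) ->
  exists t : seq (A * L),
    span_set s = (\bigcup_(p in [set` t]) pure_set p.1 p.2)%classic.
Proof.
move=> /T_join_rank[rank rankP] K0 sK.
(* [u] stands in for a greatest element of [L]. *)
pose u : L := \join_(q <- s) q.2.
pose f0 k : L := \join_(q <- s | val k <= q.1) q.2.
have sub2 (q : A * L) : q \in s -> q.2 <= u by move=> qs; exact: joins_sup_seq.
have f0u k : f0 k <= u by apply/joinsP_seq => q qs _; exact: sub2.
have f0anti : {homo f0 : x y / x <= y >-> y <= x}.
  move=> x y xy; apply/joinsP_seq => q qs yq; apply: joins_sup_seq => //.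
  by apply: le_trans yq.
have [f fE] := minimal_pair_step_fixpoint u f0 rankP.
have fanti := fixpoint_anti fE f0anti rankP.
(* For nonzero [k], this will be the greatest element of the section of the span at [k]. *)
pose g k : L := \big[Order.meet/u]_(p in J | p <= k) f p.
have gP k v : reflect (v <= u /\ forall p, p \in J -> p <= k -> v <= f p) (v <= g k).
  apply: (iffP (le_bigmeetP _ _ _ _)) => -[vu vf]; split=> // p.
    by move=> pJ pk; apply: vf; rewrite pJ.
  by case/andP; exact: vf.
have bs := span_set_biideal s.
have val0 : val (\bot : K) = \bot :> A.
  apply/le_anti; rewrite le0x andbT.
  by have : (\bot : K) <= ([` K0]%fset : K) by exact: le0x.
have spanJ (I : {set K}) v : (forall i, i \in I -> span_set s (val i, v)) ->
    span_set s (val (\join_(i in I) i), v).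
  move=> Iv; apply: (big_ind (fun k : K => span_set s (val k, v))) => //.
    by apply: (biideal_bot bs); left.
  by move=> x y xv yv; rewrite fsl_valU; apply: (biideal_joinl bs).
have spanf p : p \in J -> span_set s (val p, f p).
  have [n] := ubnP (rank p); elim: n p => // n IH p /ltnSE pn pJ.
  have bot0 : span_set s (val p, \bot) by apply: (biideal_bot bs); right.
  rewrite fE; apply: (biideal_joinr bs).
    rewrite /f0 big_seq_cond.
    apply: (big_ind (fun v => span_set s (val p, v))) => //.
      by move=> x y; exact: (biideal_joinr bs).
    move=> q /andP[qs pq]; apply: (biideal_down bs pq (lexx _)).
    by rewrite -surjective_pairing; exact: mem_span.
  apply: (big_ind (fun v => span_set s (val p, v))) => //.
    by move=> x y; exact: (biideal_joinr bs).
  (* By induction the span contains each [i ⊗ v], hence the tensor of their join with [v]; and [p]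
     is below this join. *)
  move=> I /asboolP mp; have [_ IJ _ pI _] := mp; set v := \big[_/_]_(i in I) _.
  apply: (biideal_down bs (pI : val p <= val _) (lexx _)); apply: spanJ => i iI.
  have iJ := fintype.subsetP IJ _ iI.
  have /le_bigmeetP[_ /(_ i iI) vf] := lexx v.
  by apply: (biideal_down bs (lexx _) vf (IH i _ iJ));
    exact: leq_trans (rankP _ _ mp _ iI) pn.
have spang k : span_set s (val k, g k).
  have kJ : k <= \join_(p in [set p in J | p <= k]) p.
    by apply: ji_le => p pJ pk; apply: joins_sup; rewrite inE pJ.
  apply: (biideal_down bs (kJ : val k <= val _) (lexx _)); apply: spanJ => p.
  rewrite inE => /andP[pJ pk]; have /gP[_ /(_ p pJ pk) gf] := lexx (g k).
  exact: (biideal_down bs (lexx _) gf (spanf p pJ)).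
exists [seq (val k, g k) | k <- enum K].
apply/seteqP; split; last first.
  move=> [x y] /bigcup_pure[_ /mapP[k _ ->]] [xy|[/= xk yg]].
    exact: (biideal_bot bs).
  exact: (biideal_down bs xk yg (spang k)).
pose S : set (A * L) := [set q | [\/ q.1 = \bot, q.2 = \bot |
  exists k : K, q.1 <= val k /\ q.2 <= g k]]%classic.
have : (span_set s `<=` S)%classic.
  apply: span_min.
    split.
    - move=> a b a' b' aa bb [/= a0|/= b0|/= [k [ak bk]]].
      + by constructor 1; apply/eqP; rewrite -lex0 -a0.
      + by constructor 2; apply/eqP; rewrite -lex0 -b0.
      + by constructor 3; exists k; split; [exact: le_trans ak|exact: le_trans bk].
    - by move=> q [|]; [constructor 1|constructor 2].
    - move=> a b0 b1 [/= ->|/= ->|/= [k [ak bk]]]; [by constructor 1|by rewrite join0x|].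
      case=> [/= ->|/= ->|/= [k' [ak' bk']]]; first by constructor 1.
        by rewrite joinx0; constructor 3; exists k.
      constructor 3; exists (k `&` k'); rewrite fsl_valI lexI ak ak'; split=> //=.
      have /gP[b0u b0f] := bk; have /gP[b1u b1f] := bk'.
      apply/gP; rewrite leUx b0u; split=> // p pJ; rewrite lexI => /andP[pk pk'].
      by rewrite leUx b0f ?b1f.
    - move=> a0 a1 b [/= ->|/= ->|/= [k [ak bk]]]; [by rewrite join0x|by constructor 2|].
      case=> [/= ->|/= ->|/= [k' [ak' bk']]].
      + by rewrite joinx0; constructor 3; exists k.
      + by constructor 2.
      constructor 3; exists (k `|` k'); rewrite fsl_valU /= leU2 //; split=> //.
      have /gP[bu bf] := bk; have /gP[_ bf'] := bk'.
      apply/gP; split=> // p pJ pkk.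
      (* Together, the join-irreducible elements below [k] or [k'] cover every [p] below the join of
         [k] and [k']. *)
      pose Q := [set q in J | (q <= k) || (q <= k')].
      have QJ : Q \subset J by apply/fintype.subsetP => q; rewrite inE => /andP[].
      apply: (fixpoint_join_cover fE pJ QJ) => // [|q x|q].
      + apply: le_trans pkk _; rewrite leUx; apply/andP; split.
          by apply: ji_le => q qJ qk; apply: joins_sup; rewrite inE qJ qk.
        by apply: ji_le => q qJ qk; apply: joins_sup; rewrite inE qJ qk orbT.
      + by move=> /(fintype.subsetP QJ) qJ xJ; apply: fanti.
      + by rewrite inE => /andP[qJ /orP[]]; [exact: bf|exact: bf'].
  move=> q qs; constructor 3; have qK := sK _ qs.
  exists ([` qK]%fset : K); split; first by [].
  apply/gP; split; first exact: sub2.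
  move=> p pJ pq; rewrite fE; apply: lexU2; apply/orP; left.
  exact: joins_sup_seq.
move=> + [x y] xy => /(_ _ xy) Sxy; apply/bigcup_pure.
have kin k : (val k, g k) \in [seq (val k, g k) | k <- enum K].
  by apply/mapP; exists k; rewrite ?mem_enum.
case: Sxy => [x0|y0|[k [xk yk]]].
- by exists (val (\bot : K), g \bot) => //; left; left.
- by exists (val (\bot : K), g \bot) => //; left; right.
- by exists (val k, g k) => //; right.
Qed.

End Capped.

Lemma T_join_amenable d (A : bLatticeType d) :
  locally_finite A -> (forall K : fin_sublattice A, T_join K) -> amenable A.
Proof.
move=> lf TA dL L I; have [s ->] := tensorP I.
(* Adding [\bot] makes the generated sublattice nonempty, with the same zero as [A]. *)
have /lf : finite_set [set` (\bot :: [seq q.1 | q <- s])]%classic by exact: finite_seq.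
set G := smallest _ _ => finG; pose k := fset_set G.
have kG x : (x \in k) = (x \in G) by rewrite in_fset_set.
have XG x : x \in \bot :: [seq q.1 | q <- s] -> x \in k.
  by move=> xs; rewrite kG inE => S [_]; apply.
have k0 : k != fset0.
  by apply/fset0Pn; exists \bot; apply: XG; rewrite mem_head.
have kC : is_sublattice [set` k]%classic.
  move=> x y; rewrite /= !kG !inE => Gx Gy; split=> S [Ssub XS];
    by have [] := Ssub x y (Gx S (conj Ssub XS)) (Gy S (conj Ssub XS)).
apply: (T_join_span_capped (TA (FinSublattice k0 kC))); first by apply: XG; rewrite mem_head.
by move=> q qs; apply: XG; rewrite in_cons map_f ?orbT.
Qed.

Theorem mainTheorem2 (d : Order.disp_t) (A : bLatticeType d) :
  [<-> amenable A;
       locally_finite A /\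
         (forall (dB : Order.disp_t) (B : bLatticeType dB), is_lattice (A ⊗ B)%type);
       locally_finite A /\ is_lattice (A ⊗ F3)%type;
       locally_finite A /\ (forall K : fin_sublattice A, T_join K)].
Proof.
tfae.
- move=> am; split; first exact: amenable_locally_finite.
  by move=> dB B; apply: capped_is_lattice; exact: am.
- by case.
- by case=> lf latA; split=> // K; exact: lattice_tensor_F3_T_join.
- by case=> lf; exact: T_join_amenable.
Qed.
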